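(* Consider the plant, reference model, offline data, online sampling times $0=t_0<t_1<\dots<t_M<t_{M+1}=\infty$ and signals $\mathcal{U}(t),\mathcal{D}(t)$ described in the context. Let $\Gamma\in\mathbb{R}^{2n\times 2n}$ be symmetric positive definite. Let $\gamma>0$ be such that $\bar W_M^\top\bar W_M\le\gamma^2\mathcal{D}(t_M)^2$, and let $Q_\gamma:=\gamma^2(I+A_{\mathrm m}^\top A_{\mathrm m})$. Assume that $\operatorname{im}R_{\mathrm m}\subseteq\operatorname{im}\mathcal{D}(t_M)$ and that $$\Theta(Q_\gamma,A_{\mathrm m})=\begin{bmatrix}0&I\\ A_{\mathrm m}^\top A_{\mathrm m}-Q_\gamma&A_{\mathrm m}-A_{\mathrm m}^\top\end{bmatrix}$$ has no eigenvalues on the imaginary axis. For any $x(0),x_{\mathrm m}(0)\in\mathbb{R}^n$ and $\Psi(0)\in\mathbb{R}^{2n\times(n+p)}$, consider the adaptive law $$\dot\Psi(t)=-\Gamma\left(\mathcal{D}(t)\Psi(t)-R_{\mathrm m}\right)$$ and the input (applied to the plant online, for $t\ge0$) $$u(t)=\mathcal{U}(t)\Psi(t)\begin{bmatrix}x(t)\\ r(t)\end{bmatrix}.$$ Then, if $$\Lambda(Q_\gamma,A_{\mathrm m},0)=Q_\gamma-A_{\mathrm m}^\top A_{\mathrm m}<0,$$ the resulting input-state trajectory satisfies $x\in\mathcal{L}_\infty^n$ and $u\in\mathcal{L}_\infty^m$. Moreover, the tracking error $e=x-x_{\mathrm m}$ satisfies $e\in\mathcal{L}_\infty^n$, and there exists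 a function $f$ of class $\mathcal{N}_0$ such that $$\lim_{t\to\infty}|e(t)|\le f\left(\|\bar W_M\|\right).$$
   Context: Plant: $\dot x(t)=A_{\mathrm s}x(t)+B_{\mathrm s}u(t)+E_{\mathrm s}w(t)$ with state $x\in\mathbb{R}^n$, input $u\in\mathbb{R}^m$, unknown bounded process noise $w\in\mathbb{R}^q$, and unknown matrices $A_{\mathrm s}\in\mathbb{R}^{n\times n}$, $B_{\mathrm s}\in\mathbb{R}^{n\times m}$, $E_{\mathrm s}\in\mathbb{R}^{n\times q}$. Reference model: $\dot x_{\mathrm m}(t)=A_{\mathrm m}x_{\mathrm m}(t)+B_{\mathrm m}r(t)$ with $x_{\mathrm m}\in\mathbb{R}^n$, reference input $r\in\mathbb{R}^p$, $m\ge p$, given matrices $A_{\mathrm m}\in\mathbb{R}^{n\times n}$ Hurwitz (all eigenvalues have negative real part) and $B_{\mathrm m}\in\mathbb{R}^{n\times p}$, and $(A_{\mathrm m},B_{\mathrm m})$ controllable. Put $R_{\mathrm m}=\begin{bmatrix}I&0\\ A_{\mathrm m}&B_{\mathrm m}\end{bmatrix}\in\mathbb{R}^{2n\times(n+p)}$. Filters: fix $\rho>0$. For a trajectory $(u,x,w)$ of the plant starting at time $0$, define $x^{\mathrm f},u^{\mathrm f},w^{\mathrm f}$ by $\dot x^{\mathrm f}=-\rho x^{\mathrm f}+x$, $\dot u^{\mathrm f}=-\rho u^{\mathrm f}+u$, $\dot w^{\mathrm f}=-\rho w^{\mathrm f}+w$ with zero initial values, and $x^{\mathrm{df}}(t)=x(t)-e^{-\rho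 t}x(0)-\rho x^{\mathrm f}(t)$. Offline data: from a plant trajectory on $[0,\mathcal{T}]$ and times $0<\tau_1<\dots<\tau_N\le\mathcal{T}$, form $X^{\mathrm D}=[x^{\mathrm{df}}(\tau_1)\cdots x^{\mathrm{df}}(\tau_N)]$, $X=[x^{\mathrm f}(\tau_1)\cdots x^{\mathrm f}(\tau_N)]$, $U=[u^{\mathrm f}(\tau_1)\cdots u^{\mathrm f}(\tau_N)]$, $W=[w^{\mathrm f}(\tau_1)\cdots w^{\mathrm f}(\tau_N)]$. Online data: let $M\ge1$ be an integer. From the online (closed-loop) plant trajectory on $[0,\infty)$, with its own clock and filters, let $X_M^{\mathrm D}=[X^{\mathrm D}\ x^{\mathrm{df}}(t_1)\cdots x^{\mathrm{df}}(t_M)]$, $X_M=[X\ x^{\mathrm f}(t_1)\cdots x^{\mathrm f}(t_M)]$, $W_M=[W\ w^{\mathrm f}(t_1)\cdots w^{\mathrm f}(t_M)]\in\mathbb{R}^{q\times(N+M)}$. Piecewise constant signals: for $t\in[0,t_1)$, $\mathcal{U}(t)=\frac1N U\begin{bmatrix}X\\ X^{\mathrm D}\end{bmatrix}^\top$ and $\mathcal{D}(t)=\frac1N\begin{bmatrix}X\\ X^{\mathrm D}\end{bmatrix}\begin{bmatrix}X\\ X^{\mathrm D}\end{bmatrix}^\top$; for $t\in[t_j,t_{j+1})$, $j\in\{1,\dots,M\}$, $$\mathcal{U}(t)=\tfrac{N+j-1}{N+j}\mathcal{U}(t_{j-1})+\tfrac1{N+j}u^{\mathrm f}(t_j)\begin{bmatrix}x^{\mathrm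 f}(t_j)\\ x^{\mathrm{df}}(t_j)\end{bmatrix}^\top,\qquad \mathcal{D}(t)=\tfrac{N+j-1}{N+j}\mathcal{D}(t_{j-1})+\tfrac1{N+j}\begin{bmatrix}x^{\mathrm f}(t_j)\\ x^{\mathrm{df}}(t_j)\end{bmatrix}\begin{bmatrix}x^{\mathrm f}(t_j)\\ x^{\mathrm{df}}(t_j)\end{bmatrix}^\top.$$ $\bar W_M=\frac1{N+M}E_{\mathrm s}W_M\begin{bmatrix}X_M\\ X_M^{\mathrm D}\end{bmatrix}^\top$. Matrix inequalities are in the Loewner order; $|\cdot|$ is the Euclidean norm and $\|\cdot\|$ any matrix norm. For $Q,R\in\mathbb{R}^{n\times n}$, $c\in\mathbb{C}$: $\Lambda(Q,R,c)=Q-(R-cI)^*(R-cI)$. $\mathbb{R}_+$ is the set of non-negative reals, and $\mathcal{L}_\infty^{k}$ is the space of essentially bounded signals $\mathbb{R}_+\to\mathbb{R}^k$. A continuous function $f:\mathbb{R}_+\to\mathbb{R}_+$ is of class $\mathcal{N}_0$ if it is nondecreasing and $f(0)=0$.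
   Formalization: The reference r is assumed essentially bounded; lim is read as limsup; for the bound by f(‖W̄_M‖) it is also assumed that E_s w^f(t)→0 whenever W̄_M=0, since otherwise the claim is false; f may depend on all data and trajectories. *)

(* Defs.v *)
From HB Require Import structures.
From mathcomp Require Import all_boot all_order all_algebra.
From mathcomp Require Export complex.
From mathcomp Require Import all_classical all_reals all_analysis.

Set Implicit Arguments.
Unset Strict Implicit.
Unset Printing Implicit Defensive.

Import Order.TTheory GRing.Theory Num.Theory.
Import numFieldNormedType.Exports.

Local Open Scope classical_set_scope.
Local Open Scope ring_scope.

(* The library norm on matrices is the maximum norm, hence this one. *)
Definition enorm (R : realType) (k : nat) (v : 'cV[R]_k) : R :=
  Num.sqrt (\sum_(i < k) v i 0 ^+ 2).

Definition matrix_norm (R : realType) (a b : nat) (nu : 'M[R]_(a, b) -> R) :=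
  [/\ forall A, 0 <= nu A,
      forall A, nu A = 0 -> A = 0,
      forall c A, nu (c *: A) = `|c| * nu A
    & forall A B, nu (A + B) <= nu A + nu B].

(* Symmetry is part of (semi)definiteness. *)
Definition psd (R : realType) (k : nat) (P : 'M[R]_k) :=
  P^T = P /\ forall v : 'cV[R]_k, 0 <= (v^T *m P *m v) 0 0.

Definition posdef (R : realType) (k : nat) (P : 'M[R]_k) :=
  P^T = P /\ forall v : 'cV[R]_k, v != 0 -> 0 < (v^T *m P *m v) 0 0.

Definition loewner_le (R : realType) (k : nat) (P Q : 'M[R]_k) := psd (Q - P).

Definition toC (R : realType) (a b : nat) (A : 'M[R]_(a, b)) : 'M[R[i]]_(a, b) :=
  map_mx (real_complex R) A.

Definition ctr (R : realType) (a b : nat) (A : 'M[R[i]]_(a, b)) :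
  'M[R[i]]_(b, a) := (map_mx (@conjc R) A)^T.

Definition hermitian_negdef (R : realType) (k : nat) (P : 'M[R[i]]_k) :=
  ctr P = P /\ forall v : 'cV[R[i]]_k, v != 0 -> (ctr v *m P *m v) 0 0 < 0.

Definition hurwitz (R : realType) (k : nat) (A : 'M[R]_k) :=
  forall z : R[i], eigenvalue (toC A) z -> complex.Re z < 0.

Definition Lambda (R : realType) (n : nat) (Q A : 'M[R]_n) (c : R[i]) :
    'M[R[i]]_n :=
  toC Q - ctr (toC A - c%:M) *m (toC A - c%:M).

Definition Theta (R : realType) (n : nat) (Q A : 'M[R]_n) : 'M[R]_(n + n) :=
  block_mx 0 1%:M (A^T *m A - Q) (A - A^T).

(* Essential boundedness (w.r.t. Lebesgue measure) on the time set J; signals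
   are total functions of which only the restriction to J matters. *)
Definition ess_bounded (R : realType) (k : nat) (J : set R)
    (f : R -> 'cV[R]_k) :=
  (forall i, measurable_fun J (fun t => f t i 0)) /\
  exists C : R, {ae (@lebesgue_measure R), forall t, J t -> enorm (f t) <= C}.

Definition Linfty (R : realType) (k : nat) (f : R -> 'cV[R]_k) :=
  ess_bounded `[0, +oo[%classic f.

(* [ode_on J z v] is dz/dt = v on J in the sense of Caratheodory: v is
   integrable on [0, t] and z(t) = z(0) + \int_0^t v for all t in J.  This is
   the meaning given to all differential equations, since their right-hand
   sides are in general discontinuous. *)
Definition ode_on (R : realType) (J : set R) (a b : nat)
    (z v : R -> 'M[R]_(a, b)) :=
  forall t, J t -> forall i j,
    (@lebesgue_measure R).-integrable `[0, t]%classic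
      (fun s => (v s i j)%:E) /\
    z t i j = z 0 i j +
      \int[@lebesgue_measure R]_(s in `[0, t]%classic) v s i j.

Definition controllable (R : realType) (n p : nat)
    (A : 'M[R]_n) (B : 'M[R]_(n, p)) :=
  forall x0 x1 : 'cV[R]_n,
    exists (T : R) (u : R -> 'cV[R]_p) (x : R -> 'cV[R]_n),
      [/\ 0 < T,
          ess_bounded `[0, T]%classic u,
          ode_on `[0, T]%classic x (fun t => A *m x t + B *m u t),
          x 0 = x0
        & x T = x1].

(* zf is the output on J of the first-order low-pass filter fed with z. *)
Definition filter_of (R : realType) (rho : R) (J : set R) (k : nat)
    (z zf : R -> 'cV[R]_k) :=
  zf 0 = 0 /\ ode_on J zf (fun t => - rho *: zf t + z t).

Definition filtered_trajectory (R : realType) (n m q : nat)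
    (A : 'M[R]_n) (B : 'M[R]_(n, m)) (E : 'M[R]_(n, q)) (rho : R) (J : set R)
    (u : R -> 'cV[R]_m) (x : R -> 'cV[R]_n) (w : R -> 'cV[R]_q)
    (uf : R -> 'cV[R]_m) (xf : R -> 'cV[R]_n) (wf : R -> 'cV[R]_q) :=
  [/\ ode_on J x (fun t => A *m x t + B *m u t + E *m w t),
      ess_bounded J w,
      filter_of rho J u uf,
      filter_of rho J x xf
    & filter_of rho J w wf].

Definition xdf (R : realType) (n : nat) (rho : R) (x xf : R -> 'cV[R]_n)
    (t : R) : 'cV[R]_n :=
  x t - expR (- (rho * t)) *: x 0 - rho *: xf t.

Definition snapshots (R : realType) (k : nat) (z : R -> 'cV[R]_k)
    (N : nat) (tau : 'I_N -> R) : 'M[R]_(k, N) :=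
  \matrix_(i, j) z (tau j) i 0.

Fixpoint running_average (R : realType) (a b N : nat) (S0 : 'M[R]_(a, b))
    (inc : nat -> 'M[R]_(a, b)) (j : nat) : 'M[R]_(a, b) :=
  if j is j'.+1 then
    ((N + j - 1)%:R / (N + j)%:R) *: running_average N S0 inc j'
    + ((N + j)%:R)^-1 *: inc j
  else S0.

(* The index j <= M with ts j <= t < ts j.+1, reading ts M.+1 as +oo. *)
Definition sample_index (R : realType) (M : nat) (ts : nat -> R) (t : R) : nat :=
  (\max_(j < M.+1 | (ts j <= t)%R) j)%N.

Definition averaged_signal (R : realType) (a b N M : nat) (ts : nat -> R)
    (S0 : 'M[R]_(a, b)) (inc : nat -> 'M[R]_(a, b)) (t : R) : 'M[R]_(a, b) :=
  running_average N S0 inc (sample_index M ts t).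

Definition class_N0 (R : realType) (f : R -> R) :=
  [/\ {within `[0, +oo[%classic, continuous f},
      forall s, 0 <= s -> 0 <= f s,
      forall s s', 0 <= s -> s <= s' -> f s <= f s'
    & f 0 = 0].

(* Main.v *)
Require Import Defs.
From HB Require Import structures.
From mathcomp Require Import all_boot all_order all_algebra.
From mathcomp Require Import complex.
From mathcomp Require Import all_classical all_reals all_analysis.
From mathcomp Require Import ring lra.

Set Implicit Arguments.
Unset Strict Implicit.
Unset Printing Implicit Defensive.

Import Order.TTheory GRing.Theory Num.Theory.
Import numFieldNormedType.Exports.

Local Open Scope classical_set_scope.
Local Open Scope ring_scope.

(** The averages over offline and online samples are Gram matrices of the
    filtered data Z: D(t_M) = Z Z^T / (N + M), and U(t_M) and Wbar have the same
    shape with another left factor ([running_average_gram]).  Filtering the plant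
    equation gives x^df = A_s x^f + B_s u^f + E_s w^f at every sample
    ([filter_identity]), hence B_s U(t_M) = [-A_s I] D(t_M) - Wbar.  As the range
    of a Gram matrix is that of its factor ([gram_factor]), both U(t_M) and Wbar
    factor through D = D(t_M), so the input depends on Psi only through D Psi.

    After t_M the adaptive law is a linear gradient flow.  Factoring D = B K with
    full ranks removes its neutral directions and leaves the matrix - K Gamma B,
    whose spectrum is stable ([reduced_gradient_stable]); therefore D Psi tends to
    R_m ([adaptive_convergence]).  Inserting this in the plant equation
    ([closed_loop_field]), with R_m = D Ps and Ps = [Ps1 Ps2], the loop becomes
      dx/dt = (A_m - Wbar Ps1) x + (B_m - Wbar Ps2) r + (vanishing)(x, r) + E_s w.

    The noise bound on Wbar makes the quadratic form of the perturbation Wbar Ps1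
    at most Q_gamma ([data_consistent_perturbation]).  The matrix
    Lambda(Q, A, i y) is singular exactly when i y is an eigenvalue of
    Theta(Q, A); being negative definite at y = 0 and never singular, it is
    negative definite for all y ([Lambda_imag_neg]).  So no admissible
    perturbation of A_m puts an eigenvalue on the imaginary axis, and, moving
    continuously from A_m, the perturbed matrix stays Hurwitz
    ([quadratically_bounded_stable]).  Both arguments rest on one homotopy
    principle ([stable_homotopy]).

    Trajectories are only absolutely continuous, so the stability estimates avoid
    differentiation: a stable matrix has a norm contracted by small Euler steps
    ([contracting_norm]), and one compares the trajectory with its Euler step
    through increments ([ode_increment], [stable_step], [stable_tracking]).  This
    bounds x, hence u and e.  The function f may depend on the whole experiment: if
    Wbar is not 0, a linear function through the bound of e at the norm of Wbar
    will do, and if Wbar = 0, then x - x_m - E_s w^f solves a Hurwitz system with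
    vanishing forcing, so e tends to 0. *)

(** * A contracting norm for a matrix with stable spectrum *)

Section ContractingNorm.
Variable R : realType.
Local Notation C := R[i].
Local Notation normc := Normc.normc.

(** Phrased with column eigenvectors, the form in which it is used for complex
    matrices; [hurwitz] of the real case implies it. *)
Definition stable_spectrum (k : nat) (A : 'M[C]_k) :=
  forall (z : C) (v : 'cV[C]_k), v != 0 -> A *m v = z *: v -> complex.Re z < 0.

Definition vnorm1 (k : nat) (v : 'cV[C]_k) : R := \sum_i normc (v i 0).

Definition mnorm1 (k : nat) (A : 'M[C]_k) : R := \sum_i \sum_j normc (A i j).

(** The last clause is a discrete logarithmic-norm bound: an explicit Euler step of
    length h <= d contracts by 1 - d h.  One constant K serves both comparisons
    with the l1 norm, and one d serves as rate and as maximal step. *)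
Definition contracting (k : nat) (A : 'M[C]_k) (nrm : 'cV[C]_k -> R) (K d : R) :=
  [/\ forall u v, nrm (u + v) <= nrm u + nrm v,
      forall z v, nrm (z *: v) = normc z * nrm v,
      forall v, nrm v <= K * vnorm1 v,
      forall v, vnorm1 v <= K * nrm v
    & forall h v, 0 <= h <= d -> nrm (v + h%:C%C *: (A *m v)) <= (1 - d * h) * nrm v].

Lemma normc_ge0 (z : C) : 0 <= normc z.
Proof. by case: z => a b; exact: sqrtr_ge0. Qed.

Lemma normc_sqr (z : C) : normc z ^+ 2 = complex.Re z ^+ 2 + complex.Im z ^+ 2.
Proof. by case: z => a b /=; rewrite sqr_sqrtr // addr_ge0 ?sqr_ge0. Qed.

Lemma ler_normcD (y z : C) : normc (y + z) <= normc y + normc z.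
Proof. exact: (@le_normcD R y z). Qed.

Lemma normc_sum (I : Type) (r : seq I) (P : pred I) (F : I -> C) :
  normc (\sum_(i <- r | P i) F i) <= \sum_(i <- r | P i) normc (F i).
Proof.
elim/big_ind2: _ => [|x x' y y' Hx Hy|//]; first by rewrite Normc.normc0.
exact: le_trans (ler_normcD _ _) (lerD Hx Hy).
Qed.

Lemma ReM_real (a : R) (z : C) : complex.Re (a%:C%C * z) = a * complex.Re z.
Proof. by case: z => x y /=; rewrite mul0r subr0. Qed.

Lemma normc_real (a : R) : normc a%:C%C = `|a|.
Proof. by rewrite /= expr0n addr0 sqrtr_sqr. Qed.

Lemma vnorm1_ge0 k (v : 'cV[C]_k) : 0 <= vnorm1 v.
Proof. by apply: sumr_ge0 => i _; exact: normc_ge0. Qed.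

Lemma mnorm1_ge0 k (A : 'M[C]_k) : 0 <= mnorm1 A.
Proof. by apply: sumr_ge0 => i _; apply: sumr_ge0 => j _; exact: normc_ge0. Qed.

Lemma normc_le_vnorm1 k (v : 'cV[C]_k) i : normc (v i 0) <= vnorm1 v.
Proof.
rewrite /vnorm1 (bigD1 i) //= lerDl.
by apply: sumr_ge0 => j _; exact: normc_ge0.
Qed.

Lemma vnorm1_eq0 k (v : 'cV[C]_k) : vnorm1 v <= 0 -> v = 0.
Proof.
move=> v0; apply/colP => i; rewrite mxE; apply: Normc.eq0_normc.
by apply/eqP; rewrite eq_le normc_ge0 andbT (le_trans (normc_le_vnorm1 v i)).
Qed.

Lemma vnorm1_mulmx k (A : 'M[C]_k) (v : 'cV[C]_k) :
  vnorm1 (A *m v) <= mnorm1 A * vnorm1 v.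
Proof.
rewrite /mnorm1 mulr_suml; apply: ler_sum => i _; rewrite mxE.
apply: le_trans (normc_sum _ _ _) _; rewrite mulr_suml; apply: ler_sum => j _.
by rewrite Normc.normcM ler_wpM2l ?normc_ge0 ?normc_le_vnorm1.
Qed.

Lemma det0_colvec k (A : 'M[C]_k) : \det A = 0 -> exists2 v : 'cV[C]_k, v != 0 & A *m v = 0.
Proof.
rewrite -det_tr => /eqP/det0P[v v0 vA]; exists v^T.
  by apply: contraNneq v0 => /(congr1 trmx); rewrite trmxK trmx0 => ->.
by apply: trmx_inj; rewrite trmx_mul trmxK vA trmx0.
Qed.

Lemma colvec_det0 k (A : 'M[C]_k) (v : 'cV[C]_k) : v != 0 -> A *m v = 0 -> \det A = 0.
Proof.
move=> v0 Av; apply/eqP; rewrite -det_tr; apply/det0P; exists v^T.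
  by apply: contraNneq v0 => /(congr1 trmx); rewrite trmxK trmx0 => ->.
by rewrite -trmx_mul Av trmx0.
Qed.

Lemma stable_detP k (A : 'M[C]_k) z :
  stable_spectrum A -> \det (z%:M - A) = 0 -> complex.Re z < 0.
Proof.
move=> sA /det0_colvec[v v0 /eqP]; rewrite mulmxBl mul_scalar_mx subr_eq0.
by move=> /eqP/esym; exact: sA.
Qed.

(** Schur's theorem, extended to dimension 0. *)
Lemma triangularization k (A : 'M[C]_k) :
  exists P T : 'M[C]_k, [/\ P \in unitmx, is_trig_mx T & P *m A = T *m P].
Proof.
case: k => [|k] in A *.
  by exists 1%:M, 0; split; rewrite ?unitmx1 ?mx0_is_trig //; apply/matrixP => -[].
have [P Pu PA] := @Schur _ _ A (ltn0Sn k).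
exists P, (conjmx P A); split=> //; first exact: unitarymx_unit.
by rewrite conjumx ?unitarymx_unit // mulmxKV ?unitarymx_unit.
Qed.

Lemma det_triangularized k (A P T : 'M[C]_k) z :
  P \in unitmx -> is_trig_mx T -> P *m A = T *m P ->
  \det (z%:M - A) = \prod_i (z - T i i).
Proof.
move=> Pu Tt PA; have -> : z%:M - A = invmx P *m (z%:M - T) *m P.
  rewrite mulmxBr mulmxBl -[_ *m T *m P]mulmxA -PA mulKmx // mul_mx_scalar.
  by rewrite -scalemxAl mulVmx // scalemx1.
rewrite !det_mulmx mulrAC -det_mulmx mulVmx // det1 mul1r det_trig; last first.
  apply/is_trig_mxP => i j ij; rewrite !mxE (is_trig_mxP Tt) // subr0.
  by rewrite (_ : (i == j) = false) // -val_eqE /= ltn_eqF.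
by apply: eq_bigr => i _; rewrite !mxE eqxx.
Qed.

Lemma stable_trig_diag k (A P T : 'M[C]_k) i :
  P \in unitmx -> is_trig_mx T -> P *m A = T *m P -> stable_spectrum A ->
  complex.Re (T i i) < 0.
Proof.
move=> Pu Tt PA sA; apply: (stable_detP sA).
by rewrite (det_triangularized _ Pu Tt PA) (bigD1 i) //= subrr mul0r.
Qed.

(** A complex number of negative real part is pushed inside the unit disc by
    1 + h z: the term h^2 |z|^2 in |1 + h z|^2 is dominated by h Re z for small h. *)
Lemma normc_euler_step (z : C) : complex.Re z < 0 ->
  exists2 d : R, 0 < d & forall h, 0 <= h <= d -> normc (1 + h%:C%C * z) <= 1 - d * h.
Proof.
case: z => a b /= a0.
have s0 : 0 < a ^+ 2 + b ^+ 2 by rewrite ltr_pwDl ?sqr_ge0 // expr2 nmulr_rgt0.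
have d0 : 0 < Num.min (- a / 2) (- a / (a ^+ 2 + b ^+ 2)).
  by rewrite lt_min !divr_gt0 // oppr_gt0.
exists (Num.min (- a / 2) (- a / (a ^+ 2 + b ^+ 2))) => // h /andP[h0].
move: d0; set d := Num.min _ _ => d0.
have d1 : d <= - a / 2 by rewrite ge_min lexx.
have : d <= - a / (a ^+ 2 + b ^+ 2) by rewrite ge_min lexx orbT.
rewrite ler_pdivlMr // => d2 hd.
have hs : h * (a ^+ 2 + b ^+ 2) <= - a by apply: le_trans d2; rewrite ler_wpM2r // ltW.
have ha : h * - a <= 1.
  rewrite -(ler_pM2r (_ : 0 < - a)) ?oppr_gt0 // mul1r.
  apply: le_trans hs; rewrite -mulrA mulrNN ler_wpM2l // -expr2 lerDl; exact: sqr_ge0.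
rewrite !mul0r subr0 add0r addr0.
have q0 : 0 <= 1 - d * h by nra.
rewrite -(ger0_norm q0) -sqrtr_sqr ler_wsqrtr //.
have q1 : 1 + h * a / 2 <= 1 - d * h by nra.
have q2 : 0 <= 1 + h * a / 2 by nra.
apply: (@le_trans _ _ ((1 + h * a / 2) ^+ 2)); last by rewrite ler_sqr ?nnegrE.
have : h * (h * (a ^+ 2 + b ^+ 2)) <= h * - a by rewrite ler_wpM2l.
nra.
Qed.

Lemma common_lower_bound k (d : 'I_k -> R) : (forall i, 0 < d i) ->
  exists2 e, 0 < e & forall i, e <= d i.
Proof.
move=> d0; exists (\big[Num.min/1]_i d i); last by move=> i; exact: bigmin_le.
by elim/big_ind: _ => // x y x0 y0; rewrite lt_min x0.
Qed.

(** In triangular coordinates the diagonal contracts, and the strictly lower part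
    only feeds earlier coordinates into later ones; the weights b^i with b small
    make this coupling smaller than half of the contraction rate. *)
Lemma contracting_norm k (A : 'M[C]_k) : stable_spectrum A ->
  exists nrm K d, [/\ 0 < K, 0 < d & contracting A nrm K d].
Proof.
move=> sA; have [P [T [Pu Tt PA]]] := triangularization A.
have /choice[d0 d0P] : forall i, exists d : R, 0 < d /\
    forall h, 0 <= h <= d -> normc (1 + h%:C%C * T i i) <= 1 - d * h.
  move=> i; have [d ? ?] := normc_euler_step (stable_trig_diag i Pu Tt PA sA).
  by exists d.
have [d d_gt0 dP] := common_lower_bound (fun i => (d0P i).1).
have {d0 d0P dP} dP i h : 0 <= h <= d -> normc (1 + h%:C%C * T i i) <= 1 - d * h.
  move=> /andP[h0 hd]; apply: le_trans ((d0P i).2 _ _) _.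
    by rewrite h0 (le_trans hd).
  by rewrite lerD2l lerN2 ler_wpM2r.
pose tau := mnorm1 T.
have tau0 : 0 <= tau := mnorm1_ge0 T.
pose b := d / (d + 2 * (tau + 1)).
have den : 0 < d + 2 * (tau + 1) by nra.
have b0 : 0 < b by rewrite divr_gt0.
have b1 : b <= 1 by rewrite ler_pdivrMr // mul1r lerDl; nra.
have btau : b * tau <= d / 2.
  by rewrite mulrAC ler_pdivrMr //; nra.
pose nrm (v : 'cV[C]_k) := \sum_(i < k) b ^+ i * normc ((P *m v) i 0).
have nrm1 v : nrm v <= vnorm1 (P *m v).
  apply: ler_sum => i _; rewrite ler_piMl ?normc_ge0 // exprn_ile1 // ltW //.
have nrm2 v : vnorm1 (P *m v) <= b ^- k * nrm v.
  rewrite mulr_sumr; apply: ler_sum => i _; rewrite mulrA ler_peMl ?normc_ge0 //.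
  rewrite mulrC ler_pdivlMr ?exprn_gt0 // mul1r.
  by apply: ler_wiXn2l; rewrite ?(ltW b0) //; exact: ltnW.
have bk0 : 0 < b ^- k by rewrite invr_gt0 exprn_gt0.
have nrm_ge0 v : 0 <= nrm v.
  by apply: sumr_ge0 => i _; rewrite mulr_ge0 ?normc_ge0 ?exprn_ge0 // ltW.
exists nrm, (1 + mnorm1 P + mnorm1 (invmx P) * b ^- k), (d / 2).
have m1 := mnorm1_ge0 P; have m2 := mnorm1_ge0 (invmx P).
split; [nra|nra|split].
- move=> u v; rewrite -big_split /=; apply: ler_sum => i _.
  rewrite -mulrDr ler_wpM2l ?exprn_ge0 ?(ltW b0) //.
  have -> : (P *m (u + v)) i 0 = (P *m u) i 0 + (P *m v) i 0 by rewrite mulmxDr mxE.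
  exact: ler_normcD.
- move=> z v; rewrite mulr_sumr; apply: eq_bigr => i _.
  have -> : (P *m (z *: v)) i 0 = z * (P *m v) i 0 by rewrite -scalemxAr mxE.
  by rewrite Normc.normcM mulrCA.
- move=> v; apply: le_trans (nrm1 v) (le_trans (vnorm1_mulmx _ _) _).
  rewrite ler_wpM2r ?vnorm1_ge0 //; nra.
- move=> v; rewrite -[v in vnorm1 v](mulKmx Pu).
  apply: le_trans (vnorm1_mulmx _ _) _.
  apply: le_trans (ler_wpM2l m2 (nrm2 v)) _.
  rewrite mulrA ler_wpM2r //; nra.
move=> h v /andP[h0 hd].
have hd' : 0 <= h <= d by rewrite h0 (le_trans hd) // ler_pdivrMr; nra.
set y := P *m v.
have Py : P *m (v + h%:C%C *: (A *m v)) = y + h%:C%C *: (T *m y).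
  by rewrite mulmxDr -scalemxAr mulmxA PA -mulmxA.
have rowwise i : normc ((P *m (v + h%:C%C *: (A *m v))) i 0) <=
    (1 - d * h) * normc (y i 0) +
    h * \sum_(j < k | (j < i)%N) normc (T i j) * normc (y j 0).
  have Ty : (T *m y) i 0 = \sum_(j < k | (j < i)%N) T i j * y j 0 + T i i * y i 0.
    rewrite mxE (bigID (fun j : 'I_k => (j < i)%N)) /=; congr (_ + _).
    rewrite (bigD1 i) ?ltnn //= big1 ?addr0 // => j /andP[ji jni].
    rewrite (is_trig_mxP Tt) ?mul0r //.
    by rewrite ltn_neqAle eq_sym val_eqE jni leqNgt.
  have -> : (P *m (v + h%:C%C *: (A *m v))) i 0 = y i 0 + h%:C%C * (T *m y) i 0.
    by rewrite Py mxE; congr (_ + _); rewrite mxE.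
  rewrite Ty.
  rewrite mulrDr addrCA addrC mulrA -{1}[y i 0]mul1r -mulrDl.
  apply: le_trans (ler_normcD _ _) _; apply: lerD.
    by rewrite Normc.normcM ler_wpM2r ?normc_ge0 ?dP.
  rewrite Normc.normcM normc_real ger0_norm // ler_wpM2l //.
  apply: le_trans (normc_sum _ _ _) _.
  by apply: ler_sum => j _; rewrite Normc.normcM.
have step : nrm (v + h%:C%C *: (A *m v)) <= (1 - d * h) * nrm v +
    h * \sum_(i < k) b ^+ i * \sum_(j < k | (j < i)%N) normc (T i j) * normc (y j 0).
  rewrite [X in _ <= X + _]mulr_sumr [X in _ <= _ + X]mulr_sumr -big_split /=.
  apply: ler_sum => i _.
  apply: le_trans (ler_wpM2l _ (rowwise i)) _; first by rewrite exprn_ge0 ?(ltW b0).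
  by rewrite mulrDr mulrCA [X in _ + X]mulrCA.
apply: le_trans step _.
(* the coupling only runs from j to i > j, where b ^+ i <= b * b ^+ j *)
have coupling : \sum_(i < k) b ^+ i * \sum_(j < k | (j < i)%N) normc (T i j) * normc (y j 0)
    <= b * tau * nrm v.
  rewrite mulrAC mulrC /tau /mnorm1 mulr_suml; apply: ler_sum => i _.
  rewrite mulr_suml mulr_sumr big_mkcond; apply: ler_sum => j _.
  case: ifP => [ji|_]; last first.
    by rewrite mulr_ge0 ?normc_ge0 // mulr_ge0 // ltW.
  rewrite mulrCA ler_wpM2l ?normc_ge0 //.
  apply: le_trans (_ : b * (b ^+ j * normc (y j 0)) <= _).
    rewrite mulrA -exprS ler_wpM2r ?normc_ge0 //.
    by apply: ler_wiXn2l; rewrite ?(ltW b0).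
  rewrite ler_wpM2l ?(ltW b0) // /nrm (bigD1 j) //= lerDl.
  by apply: sumr_ge0 => l _; rewrite mulr_ge0 ?normc_ge0 ?exprn_ge0 // ltW.
have := ler_wpM2l h0 (le_trans coupling (ler_wpM2r (nrm_ge0 v) btau)).
by have := nrm_ge0 v; nra.
Qed.

End ContractingNorm.

(** * Stability along a path without imaginary eigenvalues *)

Section Homotopy.
Variable R : realType.
Local Notation C := R[i].
Local Notation normc := Normc.normc.

Lemma Re_le_normc (z : C) : complex.Re z <= normc z.
Proof.
case: z => a b /=; apply: le_trans (ler_norm _) _; rewrite -sqrtr_sqr.
by apply: ler_wsqrtr; rewrite lerDl sqr_ge0.
Qed.

(** The contraction rate of a norm adapted to A leaves room for B - A. *)
Lemma stable_perturbation k (A : 'M[C]_k) : stable_spectrum A ->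
  exists2 e : R, 0 < e & forall B, mnorm1 (B - A) < e -> stable_spectrum B.
Proof.
move=> /contracting_norm[nrm [K [d [K0 d0 [nD nZ nK Kn nA]]]]].
exists (d / K ^+ 2); first by rewrite divr_gt0 // exprn_gt0.
move=> B BA z v v0 Bv; rewrite ltr_pdivlMr ?exprn_gt0 // in BA.
have vpos : 0 < vnorm1 v.
  by rewrite ltNge; apply: contraNN v0 => /vnorm1_eq0 ->.
have nv : 0 < nrm v by rewrite -(pmulr_rgt0 _ K0) (lt_le_trans vpos).
have dd : 0 <= d <= d by rewrite lexx ltW.
have : nrm ((1 + d%:C%C * z) *: v) <=
    nrm (v + d%:C%C *: (A *m v)) + nrm (d%:C%C *: ((B - A) *m v)).
  apply: le_trans (nD _ _); rewrite mulmxBl Bv scalerBr scalerA scalerDl scale1r.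
  by rewrite addrA [v + _ + _]addrAC addrK.
rewrite !nZ normc_real (gtr0_norm d0) => step.
have h1 := nA _ v dd.
have h2 : nrm ((B - A) *m v) <= K * (mnorm1 (B - A) * (K * nrm v)).
  apply: le_trans (nK _) _; rewrite ler_wpM2l ?(ltW K0) //.
  by apply: le_trans (vnorm1_mulmx _ _) _; rewrite ler_wpM2l ?mnorm1_ge0.
have h3 : 1 + d * complex.Re z <= normc (1 + d%:C%C * z).
  by apply: le_trans (Re_le_normc _); rewrite raddfD /= ReM_real.
have h4 : mnorm1 (B - A) * K ^+ 2 * nrm v < d * nrm v by rewrite ltr_pM2r.
have h5 := ler_wpM2r (ltW nv) h3.
have h6 := ler_wpM2l (ltW d0) h2.
have h7 : d * (mnorm1 (B - A) * K ^+ 2 * nrm v) < d * (d * nrm v) by rewrite ltr_pM2l.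
have : d * nrm v * complex.Re z < 0 by nra.
by rewrite pmulr_rlt0 // mulr_gt0.
Qed.

(** Stated on real and imaginary parts, so that only the topology of R is used. *)
Definition ccontinuous (f : R -> C) :=
  continuous (fun s => complex.Re (f s)) /\ continuous (fun s => complex.Im (f s)).

Lemma ccontinuous_cst z : ccontinuous (fun=> z).
Proof. by split=> s; exact: cvg_cst. Qed.

Lemma ccontinuousD f g : ccontinuous f -> ccontinuous g ->
  ccontinuous (fun s => f s + g s).
Proof.
move=> [f1 f2] [g1 g2]; split=> s.
  under eq_fun do rewrite raddfD /=.
  by apply: cvgD; [exact: f1|exact: g1].
under eq_fun do rewrite raddfD /=.
by apply: cvgD; [exact: f2|exact: g2].
Qed.

Lemma ccontinuousM f g : ccontinuous f -> ccontinuous g ->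
  ccontinuous (fun s => f s * g s).
Proof.
move=> [f1 f2] [g1 g2]; split.
  have -> : (fun s => complex.Re (f s * g s)) = (fun s =>
    complex.Re (f s) * complex.Re (g s) - complex.Im (f s) * complex.Im (g s)).
    by apply/funext => s; case: (f s) (g s) => [a b] [c d].
  move=> s; apply: cvgB; apply: cvgM; [exact: f1|exact: g1|exact: f2|exact: g2].
have -> : (fun s => complex.Im (f s * g s)) = (fun s =>
  complex.Re (f s) * complex.Im (g s) + complex.Im (f s) * complex.Re (g s)).
  by apply/funext => s; case: (f s) (g s) => [a b] [c d].
move=> s; apply: cvgD; apply: cvgM; [exact: f1|exact: g2|exact: f2|exact: g1].
Qed.

Lemma ccontinuous_sum (I : Type) (r : seq I) (F : I -> R -> C) :
  (forall i, ccontinuous (F i)) -> ccontinuous (fun s => \sum_(i <- r) F i s).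
Proof.
move=> Fc; elim: r => [|i r IH].
  by under eq_fun do rewrite big_nil; exact: ccontinuous_cst.
by under eq_fun do rewrite big_cons; exact: ccontinuousD.
Qed.

Lemma ccontinuous_prod (I : Type) (r : seq I) (F : I -> R -> C) :
  (forall i, ccontinuous (F i)) -> ccontinuous (fun s => \prod_(i <- r) F i s).
Proof.
move=> Fc; elim: r => [|i r IH].
  by under eq_fun do rewrite big_nil; exact: ccontinuous_cst.
by under eq_fun do rewrite big_cons; exact: ccontinuousM.
Qed.

Lemma ccontinuous_det k (A : R -> 'M[C]_k) :
  (forall i j, ccontinuous (fun s => A s i j)) -> ccontinuous (fun s => \det (A s)).
Proof.
move=> Ac; apply: ccontinuous_sum => p; apply: ccontinuousM.
  exact: ccontinuous_cst.
by apply: ccontinuous_prod => i; exact: Ac.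
Qed.

Lemma continuous_normc f : ccontinuous f -> continuous (fun s => normc (f s)).
Proof.
move=> [f1 f2] s.
pose g t := complex.Re (f t) ^+ 2 + complex.Im (f t) ^+ 2.
have -> : (fun s => normc (f s)) = @Num.sqrt R \o g.
  by apply/funext => t; rewrite /g /=; case: (f t).
apply: continuous_comp; last exact: sqrt_continuous.
by apply: cvgD; apply: cvgM; by [exact: f1|exact: f2].
Qed.

Lemma continuous_mnorm1B k (A : R -> 'M[C]_k) s0 :
  (forall i j, ccontinuous (fun s => A s i j)) ->
  continuous (fun s => mnorm1 (A s - A s0)).
Proof.
move=> Ac; rewrite /mnorm1.
have csum (F : 'I_k -> R -> R) : (forall i, continuous (F i)) ->
    continuous (fun s => \sum_i F i s).
  move=> Fc; elim: (index_enum _) => [|i r IH] s.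
    by under eq_fun do rewrite big_nil; exact: cvg_cst.
  by under eq_fun do rewrite big_cons; apply: cvgD; [exact: Fc|exact: IH].
apply: (csum) => i; apply: (csum) => j; apply: continuous_normc.
under eq_fun do rewrite !mxE.
by apply: ccontinuousD; [exact: Ac|exact: ccontinuous_cst].
Qed.

(** For an eigenvalue l_i in the open left half plane and z in the right one, moving
    z horizontally onto the imaginary axis brings it closer to l_i, so each factor
    of the characteristic polynomial decreases in modulus. *)
Lemma stable_det_le k (A : 'M[C]_k) (z : C) :
  stable_spectrum A -> 0 <= complex.Re z ->
  normc (\det ((Complex 0 (complex.Im z))%:M - A)) <= normc (\det (z%:M - A)).
Proof.
move=> sA z0; have [P [T [Pu Tt PA]]] := triangularization A.
rewrite !(det_triangularized _ Pu Tt PA).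
elim/big_ind2: _ => // [x x' y y' Hx Hy|i _].
  by rewrite !Normc.normcM ler_pM ?normc_ge0.
have := stable_trig_diag i Pu Tt PA sA.
case: z z0 (T i i) => a b /= a0 [c d] /= c0.
apply: ler_wsqrtr; rewrite lerD2r; nra.
Qed.

(** The set of parameters with stable spectrum is open by perturbation.  It is also
    closed: if A t has an eigenvalue z with Re z > 0, then near t the
    characteristic polynomial is smaller at z than at i Im z, which
    [stable_det_le] forbids for a stable matrix. *)
Lemma stable_homotopy k (A : R -> 'M[C]_k) :
  (forall i j, ccontinuous (fun s => A s i j)) ->
  (forall s y (v : 'cV[C]_k), A s *m v = (Complex 0 y) *: v -> v = 0) ->
  stable_spectrum (A 0) -> forall s, stable_spectrum (A s).
Proof.
move=> Ac noimag s0 s.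
pose S : set R := [set s | stable_spectrum (A s)].
suff ST : S = setT by have : S s by rewrite ST.
have oS : open S.
  rewrite openE => t /stable_perturbation[e e0 eP].
  have AA0 : mnorm1 (A t - A t) = 0.
    rewrite subrr /mnorm1 big1 // => i _; rewrite big1 // => j _.
    by rewrite mxE normc_real normr0.
  have : (fun u => mnorm1 (A u - A t)) u @[u --> t] --> (0 : R).
    by rewrite -AA0; exact: (@continuous_mnorm1B _ A t Ac t).
  move=> /cvgr_lt/(_ _ e0); apply: filterS => u; exact: eP.
have cS : closed S.
  rewrite -openC openE => t nSt.
  have : exists (z : C) (v : 'cV[C]_k),
      [/\ v != 0, A t *m v = z *: v & 0 <= complex.Re z].
    apply: contrapT => nex; apply: (nSt : ~ stable_spectrum (A t)) => z v v0 Av.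
    by rewrite ltNge; apply/negP => z0; case: nex; exists z, v.
  move=> [z [v [v0 Av z0]]].
  have det_cont w : ccontinuous (fun u => \det (w%:M - A u)).
    apply: ccontinuous_det => i j; under eq_fun do rewrite !mxE -mulN1r.
    apply: ccontinuousD; first exact: ccontinuous_cst.
    by apply: ccontinuousM; [exact: ccontinuous_cst|exact: Ac].
  have det_z : \det (z%:M - A t) = 0.
    by apply: colvec_det0 v0 _; rewrite mulmxBl mul_scalar_mx Av subrr.
  pose y := Complex 0 (complex.Im z).
  have gap : 0 < normc (\det (y%:M - A t)) - normc (\det (z%:M - A t)).
    rewrite det_z Normc.normc0 subr0 lt_neqAle normc_ge0 andbT eq_sym.
    apply/eqP => /Normc.eq0_normc/det0_colvec[w w0 /eqP].
    rewrite mulmxBl mul_scalar_mx subr_eq0 => /eqP/esym/noimag w0'.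
    by rewrite w0' eqxx in w0.
  have : (fun u => normc (\det (y%:M - A u)) - normc (\det (z%:M - A u))) u @[u --> t]
    --> normc (\det (y%:M - A t)) - normc (\det (z%:M - A t)).
    by apply: cvgB; exact: continuous_normc.
  move=> /cvgr_gt/(_ _ gap); apply: filterS => u /=.
  by rewrite subr_gt0 ltNge => /negP; apply: contra_not => /stable_det_le; exact.
have /connected_intervalP cT : is_interval [set: R] by [].
apply: cT; first by exists 0.
  by exists S => //; rewrite setTI.
by exists S => //; rewrite setTI.
Qed.

End Homotopy.

(** * The frequency condition and quadratically bounded perturbations *)

Section FrequencyCondition.
Variable R : realType.
Local Notation C := R[i].
Local Notation normc := Normc.normc.

Definition vRe (k : nat) (v : 'cV[C]_k) : 'cV[R]_k := map_mx (@complex.Re R) v.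
Definition vIm (k : nat) (v : 'cV[C]_k) : 'cV[R]_k := map_mx (@complex.Im R) v.

Lemma vRe_toC k l (A : 'M[R]_(l, k)) (v : 'cV[C]_k) :
  vRe (toC A *m v) = A *m vRe v.
Proof.
apply/colP => i; rewrite !mxE raddf_sum /=; apply: eq_bigr => j _.
by rewrite !mxE; case: (v j 0) => a b /=; rewrite mul0r subr0.
Qed.

Lemma vIm_toC k l (A : 'M[R]_(l, k)) (v : 'cV[C]_k) :
  vIm (toC A *m v) = A *m vIm v.
Proof.
apply/colP => i; rewrite !mxE raddf_sum /=; apply: eq_bigr => j _.
by rewrite !mxE; case: (v j 0) => a b /=; rewrite mul0r addr0.
Qed.

Lemma Re_ctr_mul k (v u : 'cV[C]_k) : complex.Re ((ctr v *m u) 0 0) =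
  ((vRe v)^T *m vRe u) 0 0 + ((vIm v)^T *m vIm u) 0 0.
Proof.
rewrite !mxE raddf_sum /= -big_split /=; apply: eq_bigr => j _.
by rewrite !mxE; case: (v j 0) (u j 0) => a b [c d] /=; rewrite mulNr opprK.
Qed.

Lemma ctrM k l m (A : 'M[C]_(k, l)) (B : 'M[C]_(l, m)) :
  ctr (A *m B) = ctr B *m ctr A.
Proof. by rewrite /ctr map_mxM trmx_mul. Qed.

Lemma ctrB k l (A B : 'M[C]_(k, l)) : ctr (A - B) = ctr A - ctr B.
Proof. by rewrite /ctr map_mxB linearB. Qed.

Lemma ctrK k l : cancel (@ctr R k l) (@ctr R l k).
Proof. by move=> A; apply/matrixP => i j; rewrite !mxE conjcK. Qed.

Lemma ctr_toC k l (A : 'M[R]_(k, l)) : ctr (toC A) = toC A^T.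
Proof. by apply/matrixP => i j; rewrite !mxE conjc_real. Qed.

Lemma Re_ctr_self_gt0 k (v : 'cV[C]_k) : v != 0 -> 0 < complex.Re ((ctr v *m v) 0 0).
Proof.
move=> /cV0Pn[i vi]; rewrite mxE raddf_sum (bigD1 i) //= ltr_pwDl //.
  rewrite !mxE; case: (v i 0) vi => a b /=; rewrite eq_complex /= negb_and mulNr opprK => ab.
  rewrite -!expr2 lt_neqAle addr_ge0 ?sqr_ge0 // andbT eq_sym paddr_eq0 ?sqr_ge0 //.
  by rewrite !sqrf_eq0 negb_and.
apply: sumr_ge0 => j _; rewrite !mxE; case: (v j 0) => a b /=.
by rewrite mulNr opprK -!expr2 addr_ge0 ?sqr_ge0.
Qed.

Lemma hermitian_form_real k (H : 'M[R[i]]_k) (v : 'cV[R[i]]_k) : ctr H = H ->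
  complex.Im ((ctr v *m (H *m v)) 0 0) = 0.
Proof.
move=> Hh; have : ctr (ctr v *m (H *m v)) = ctr v *m (H *m v).
  by rewrite !ctrM ctrK Hh mulmxA.
move=> /matrixP/(_ 0 0); rewrite [LHS]mxE [LHS]mxE.
by case: (_ 0 0) => a b /= [] /eqP; rewrite eq_sym -addr_eq0 -mulr2n mulrn_eq0 /= => /eqP.
Qed.

(** By the spectral theorem the form is a combination of squared moduli whose
    coefficients are the eigenvalues. *)
Lemma hermitian_stable_neg k (H : 'M[C]_k) : ctr H = H -> stable_spectrum H ->
  forall v : 'cV[C]_k, v != 0 -> complex.Re ((ctr v *m H *m v) 0 0) < 0.
Proof.
move=> Hh sH v v0.
have Hn : H \is normalmx.
  apply/normalmxP; have -> : map_mx Num.conj H^T = H by rewrite -[RHS]Hh /ctr map_trmx.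
  by [].
have /orthomx_spectralP := Hn.
set P := spectralmx H; set sp := spectral_diag H => HE.
have Pu : P \is unitarymx := spectral_unitarymx H.
have Pun : P \in unitmx := unitarymx_unit Pu.
have PV : invmx P = ctr P by rewrite invmx_unitary // /ctr map_trmx.
have sp_neg i : complex.Re (sp 0 i) < 0.
  apply: (sH _ (invmx P *m (delta_mx i 0 : 'cV_k))).
    apply/eqP => /(congr1 (mulmx P)); rewrite mulKVmx // mulmx0.
    by move=> /colP/(_ i)/eqP; rewrite !mxE !eqxx oner_eq0.
  rewrite HE -!mulmxA mulKVmx // scalemxAr; congr (_ *m _).
  apply/colP => j; rewrite mul_diag_mx !mxE eqxx andbT.
  by case: eqVneq => [->|_]; rewrite ?mulr0.
pose y := P *m v.
have y0 : y != 0.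
  by apply: contraNneq v0 => /(congr1 (mulmx (invmx P))); rewrite mulKmx // mulmx0 => ->.
have -> : ctr v *m H *m v = ctr y *m (diag_mx sp *m y).
  by rewrite HE PV /y ctrM -!mulmxA.
have term (w t : C) : complex.Re (conjc w * (t * w)) = complex.Re t * normc w ^+ 2.
  by rewrite normc_sqr; case: w t => a b [c d] /=; ring.
have -> : complex.Re ((ctr y *m (diag_mx sp *m y)) 0 0) =
    \sum_j complex.Re (sp 0 j) * normc (y j 0) ^+ 2.
  rewrite mxE raddf_sum; apply: eq_bigr => j _ /=; rewrite -term mul_diag_mx.
  by congr (complex.Re (_ * _)); rewrite ?mxE // /ctr !mxE.
have /cV0Pn[i yi] := y0.
have npos : 0 < normc (y i 0).
  rewrite lt_neqAle normc_ge0 andbT eq_sym; apply: contraNneq yi => /Normc.eq0_normc ->.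
  by [].
rewrite (bigD1 i) //= ltr_nwDl //.
  by rewrite nmulr_rlt0 ?exprn_gt0.
by apply: sumr_le0 => j _; rewrite nmulr_rle0 ?exprn_ge0 ?normc_ge0.
Qed.

Lemma eigenvalue_colvec k (A : 'M[C]_k) z (v : 'cV[C]_k) :
  v != 0 -> A *m v = z *: v -> eigenvalue A z.
Proof.
move=> v0 Av; have /eqP : \det (A - z%:M) = 0.
  by apply: colvec_det0 v0 _; rewrite mulmxBl mul_scalar_mx Av subrr.
move=> /det0P[u u0 /eqP]; rewrite mulmxBr mul_mx_scalar subr_eq0 => /eqP uA.
by apply/eigenvalueP; exists u.
Qed.

Lemma hurwitz_stable k (A : 'M[R]_k) : hurwitz A -> stable_spectrum (toC A).
Proof. by move=> hA z v v0 Av; apply: hA; exact: eigenvalue_colvec Av. Qed.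

Lemma ctr_imag_shift k (A : 'M[R]_k) y :
  ctr (toC A - (Complex 0 y)%:M) = toC A^T + (Complex 0 y)%:M.
Proof.
rewrite ctrB ctr_toC; congr (_ + _); apply/matrixP => i j; rewrite !mxE eq_sym.
case: eqVneq => _ /=; last by rewrite !oppr0.
by apply/eqP; rewrite eq_complex /= oppr0 !opprK !eqxx.
Qed.

Lemma Lambda_ctr n (Q A : 'M[R]_n) c : Q^T = Q -> ctr (Lambda Q A c) = Lambda Q A c.
Proof. by move=> Qs; rewrite /Lambda (ctrB (toC Q)) ctrM ctrK ctr_toC Qs.
Qed.

(** Theta is the companion linearisation of the quadratic eigenvalue problem
    (A^T A - Q) v + c (A - A^T) v = c^2 v, which for imaginary c reads
    Lambda(Q, A, c) v = 0. *)
Lemma Lambda_kernel_Theta n (Q A : 'M[R]_n) y (v : 'cV[C]_n) :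
  let c := Complex 0 y in
  Lambda Q A c *m v = 0 -> toC (Theta Q A) *m col_mx v (c *: v) = c *: col_mx v (c *: v).
Proof.
move=> c; rewrite /Lambda mulmxBl => /eqP; rewrite subr_eq0 => /eqP LQ.
rewrite /toC /Theta map_block_mx mul_block_col map_mx0 mul0mx add0r map_mx1 mul1mx.
rewrite scale_col_mx; congr col_mx.
rewrite !map_mxB /= map_mxM !mulmxBl LQ.
rewrite ctr_imag_shift.
rewrite -!mulmxA !mulmxDl !mulmxDr !mulNmx !mulmxN !mul_scalar_mx -!/(toC _).
rewrite -!scalemxAr -/c.
move: (_ *m (_ *m _)) (c *: (toC A^T *m v)) (c *: (toC A *m v)) (c *: (c *: v)) => a b d f.
by apply/colP => i; rewrite !mxE; ring.
Qed.

(** Lambda is Hermitian, so an imaginary eigenvalue can only be 0, and a kernel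
    vector would produce an imaginary eigenvalue of Theta. *)
Lemma Lambda_no_imag n (Q A : 'M[R]_n) y t (v : 'cV[C]_n) : Q^T = Q ->
  (forall c, eigenvalue (toC (Theta Q A)) c -> complex.Re c != 0) ->
  Lambda Q A (Complex 0 y) *m v = Complex 0 t *: v -> v = 0.
Proof.
move=> Qs Th Lv; apply: contrapT => /eqP v0.
pose L := Lambda Q A (Complex 0 y).
have Lh : ctr L = L by exact: Lambda_ctr.
have Hreal := hermitian_form_real v Lh.
have t0 : t = 0.
  move: Hreal; rewrite Lv -scalemxAr mxE.
  have := Re_ctr_self_gt0 v0; case: (_ 0 0) => a b /= a0.
  by rewrite mul0r add0r => /eqP; rewrite mulf_eq0 (gt_eqF a0) orbF => /eqP.
rewrite t0 (_ : Complex 0 0 = 0 :> C) // scale0r in Lv.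
have cv0 : col_mx v (Complex 0 y *: v) != 0.
  apply: contraNneq v0 => /(congr1 usubmx).
  by rewrite col_mxKu => ->; apply/eqP/colP => i; rewrite !mxE.
by have /Th := eigenvalue_colvec cv0 (Lambda_kernel_Theta Lv); rewrite /= eqxx.
Qed.

Lemma ccontinuous_imag : ccontinuous (fun s : R => Complex 0 s).
Proof. by split => s /=; [exact: cvg_cst|exact: cvg_id]. Qed.

Lemma ccontinuous_addmx k l (F G : R -> 'M[C]_(k, l)) i j :
  ccontinuous (fun s => F s i j) -> ccontinuous (fun s => G s i j) ->
  ccontinuous (fun s => (F s + G s) i j).
Proof. by move=> Fc Gc; under eq_fun do rewrite mxE; exact: ccontinuousD. Qed.

Lemma ccontinuous_oppmx k l (F : R -> 'M[C]_(k, l)) i j :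
  ccontinuous (fun s => F s i j) -> ccontinuous (fun s => (- F s) i j).
Proof.
move=> Fc; under eq_fun do rewrite mxE -mulN1r.
by apply: ccontinuousM => //; exact: ccontinuous_cst.
Qed.

Lemma ccontinuous_mulmx k l m (F : R -> 'M[C]_(k, l)) (G : R -> 'M[C]_(l, m)) i j :
  (forall i j, ccontinuous (fun s => F s i j)) ->
  (forall i j, ccontinuous (fun s => G s i j)) ->
  ccontinuous (fun s => (F s *m G s) i j).
Proof.
move=> Fc Gc; under eq_fun do rewrite mxE.
by apply: ccontinuous_sum => h; exact: ccontinuousM.
Qed.

Lemma ccontinuous_scalar_mx k (f : R -> C) (i j : 'I_k) :
  ccontinuous f -> ccontinuous (fun s => (f s)%:M i j).
Proof.
move=> fc; under eq_fun do rewrite mxE -mulr_natr.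
by apply: ccontinuousM => //; exact: ccontinuous_cst.
Qed.

(** For a Hermitian matrix, negative definite means stable spectrum, so negativity
    propagates from y = 0 by [stable_homotopy]. *)
Lemma Lambda_imag_neg n (Q A : 'M[R]_n) : Q^T = Q ->
  (forall c, eigenvalue (toC (Theta Q A)) c -> complex.Re c != 0) ->
  hermitian_negdef (Lambda Q A 0) ->
  forall y (v : 'cV[C]_n), v != 0 ->
    complex.Re ((ctr v *m Lambda Q A (Complex 0 y) *m v) 0 0) < 0.
Proof.
move=> Qs Th [_ L0] y.
apply: hermitian_stable_neg; first exact: Lambda_ctr.
apply: (stable_homotopy (A := fun y => Lambda Q A (Complex 0 y))) => [i j|s t v|z v v0 Lv].
- apply: ccontinuous_addmx; first exact: ccontinuous_cst.
  apply: ccontinuous_oppmx.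
  under eq_fun do rewrite ctr_imag_shift.
  apply: ccontinuous_mulmx => {}i {}j; apply: ccontinuous_addmx;
    (try exact: ccontinuous_cst).
    exact: ccontinuous_scalar_mx ccontinuous_imag.
  by apply: ccontinuous_oppmx; exact: ccontinuous_scalar_mx ccontinuous_imag.
- exact: Lambda_no_imag.
have := L0 v v0; rewrite -mulmxA Lv -scalemxAr mxE ltcE /=.
have := Re_ctr_self_gt0 v0.
have : complex.Im ((ctr v *m v) 0 0) = 0.
  rewrite mxE raddf_sum big1 // => i _ /=; rewrite !mxE.
  by case: (v i 0) => a b /=; ring.
case: (_ 0 0) => a b /= -> a0; case: z {Lv} => c d /=; rewrite !mulr0 subr0 => /andP[_].
by rewrite pmulr_llt0.
Qed.

(** If i y were an eigenvalue of A + t D with |t| <= 1 and eigenvector v, then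
    |(A - i y) v| = |t D v| <= sqrt (v^* Q v), contradicting Lambda(Q, A, i y) < 0.
    The path is t = sin s: it starts at 0, reaches 1 and keeps |t| <= 1 for every
    real s. *)
Lemma quadratically_bounded_stable n (Q A D : 'M[R]_n) : Q^T = Q -> hurwitz A ->
  (forall c, eigenvalue (toC (Theta Q A)) c -> complex.Re c != 0) ->
  hermitian_negdef (Lambda Q A 0) ->
  (forall v : 'cV[R]_n, ((D *m v)^T *m (D *m v)) 0 0 <= (v^T *m Q *m v) 0 0) ->
  stable_spectrum (toC (A + D)).
Proof.
move=> Qs hA Th L0 DQ.
have Lneg := Lambda_imag_neg Qs Th L0.
have toCD s : toC (A + s *: D) = toC A + s%:C%C *: toC D.
  by apply/matrixP => i j; rewrite !mxE rmorphD rmorphM.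
rewrite -[D]scale1r -(sin_pihalf R).
apply: (stable_homotopy (A := fun s => toC (A + sin s *: D))) => [i j|s y v Av|].
- under eq_fun do rewrite mxE.
  split; last by move=> s; exact: cvg_cst.
  under eq_fun do rewrite /= 2!mxE.
  move=> s; apply: cvgD; first exact: cvg_cst.
  by apply: cvgM; [exact: continuous_sin|exact: cvg_cst].
- apply: contrapT => /eqP v0.
  have := Lneg y v v0; rewrite ltNge => /negP; apply.
  set t := sin s in Av; pose u := (toC A - (Complex 0 y)%:M) *m v.
  have uE : u = toC (- t *: D) *m v.
    have -> : toC (- t *: D) = toC A - toC (A + t *: D).
      by apply/matrixP => i j; rewrite !mxE -rmorphB /=; congr (_%:C%C); ring.
    by rewrite /u mulmxBl mul_scalar_mx -Av -mulmxBl.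
  have -> : ctr v *m Lambda Q A (Complex 0 y) *m v = ctr v *m (toC Q *m v) - ctr u *m u.
    by rewrite /Lambda mulmxBr mulmxBl /u ctrM !mulmxA.
  rewrite mxE [X in _ + X]mxE raddfB /= !Re_ctr_mul uE !vRe_toC !vIm_toC.
  have tD (a : 'cV[R]_n) : (((- t *: D) *m a)^T *m ((- t *: D) *m a)) 0 0 <=
      (a^T *m (Q *m a)) 0 0.
    have sqZ (w : 'cV[R]_n) : ((- t *: w)^T *m (- t *: w)) 0 0 = t * t * (w^T *m w) 0 0.
      have -> : (- t *: w)^T = - t *: w^T by apply/matrixP => i j; rewrite !mxE.
      by rewrite -scalemxAl -scalemxAr scalerA mulrNN mxE.
    rewrite -!scalemxAl sqZ.
    apply: le_trans (_ : ((D *m a)^T *m (D *m a)) 0 0 <= _); last first.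
      by have := DQ a; rewrite -(mulmxA a^T).
    rewrite ler_piMl //.
      by rewrite mxE sumr_ge0 // => i _; rewrite mxE -expr2 sqr_ge0.
    by rewrite -expr2 -[leRHS](cos2Dsin2 s) lerDr sqr_ge0.
  by rewrite subr_ge0 lerD.
by rewrite sin0 scale0r addr0; exact: hurwitz_stable.
Qed.

End FrequencyCondition.

(** * The spectrum of the adaptation dynamics *)

Section AdaptationSpectrum.
Variable R : realType.

Lemma toC_mulmx a b c (A : 'M[R]_(a, b)) (B : 'M[R]_(b, c)) :
  toC (A *m B) = toC A *m toC B.
Proof. by rewrite /toC map_mxM. Qed.

Lemma Re_form_ge0 k (D : 'M[R]_k) (v : 'cV[R[i]]_k) :
  (forall a : 'cV[R]_k, 0 <= (a^T *m D *m a) 0 0) ->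
  0 <= complex.Re ((ctr v *m (toC D *m v)) 0 0).
Proof. by move=> D0; rewrite Re_ctr_mul vRe_toC vIm_toC !mulmxA addr_ge0. Qed.

Lemma Re_form_gt0 k (G : 'M[R]_k) (v : 'cV[R[i]]_k) : posdef G -> v != 0 ->
  0 < complex.Re ((ctr v *m (toC G *m v)) 0 0).
Proof.
move=> [_ G0] v0; rewrite Re_ctr_mul vRe_toC vIm_toC !mulmxA.
have G_ge0 (a : 'cV[R]_k) : 0 <= (a^T *m G *m a) 0 0.
  by have [->|/G0/ltW//] := eqVneq a 0; rewrite mulmx0 mxE.
have [a0|/G0 a0] := eqVneq (vRe v) 0; last by rewrite ltr_pwDl.
have [b0|/G0 b0] := eqVneq (vIm v) 0; last by rewrite ltr_wpDl.
case/negP: v0; apply/eqP/colP => i; rewrite mxE.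
have /colP/(_ i) := a0; have /colP/(_ i) := b0; rewrite !mxE.
by case: (v i 0) => a b /= -> ->.
Qed.

(** If - K G B v = z v, then th = B v = D phi for some phi, and D G th = - z th.
    Pairing with G th gives (G th)^* D (G th) = - z th^* G th, where both forms are
    real, the left one nonnegative and the right one positive, so z <= 0; and z = 0
    would give th^* G th = phi^* D G th = 0. *)
Lemma reduced_gradient_stable k r (G D : 'M[R]_k) (B : 'M[R]_(k, r)) (K : 'M[R]_(r, k)) :
  posdef G -> D^T = D -> (forall a : 'cV[R]_k, 0 <= (a^T *m D *m a) 0 0) ->
  D = B *m K -> row_full B -> row_free K ->
  stable_spectrum (toC (- (K *m G *m B))).
Proof.
move=> Gp Ds D0 DE Bf Kf z v v0 Av; have [Gs _] := Gp.
pose phi := toC (pinvmx K) *m v; pose th := toC B *m v.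
have thE : th = toC D *m phi.
  have KK : toC K *m toC (pinvmx K) = 1%:M.
    by rewrite -toC_mulmx mulmxVp // /toC map_mx1.
  by rewrite /th /phi DE toC_mulmx -mulmxA (mulmxA (toC K)) KK mul1mx.
have th0 : th != 0.
  apply: contraNneq v0 => /(congr1 (mulmx (toC (pinvmx B)))).
  by rewrite mulmxA -toC_mulmx mulVpmx // /toC map_mx1 mul1mx mulmx0 => ->.
have DGth : toC D *m (toC G *m th) = - z *: th.
  have -> : toC D *m (toC G *m th) = - (toC B *m (toC (- (K *m G *m B)) *m v)).
    by rewrite /th !mulmxA -!toC_mulmx -mulNmx mulmxN /toC map_mxN opprK DE !mulmxA.
  by rewrite Av -scalemxAr scaleNr.
have Gh : ctr (toC G) = toC G by rewrite ctr_toC Gs.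
have Dh : ctr (toC D) = toC D by rewrite ctr_toC Ds.
have beta : ctr (toC G *m th) *m (toC D *m (toC G *m th)) = - z *: (ctr th *m (toC G *m th)).
  by rewrite DGth -scalemxAr ctrM Gh mulmxA.
have a0 := Re_form_gt0 Gp th0; have ai := hermitian_form_real th Gh.
have b0 := Re_form_ge0 (toC G *m th) D0; have bi := hermitian_form_real (toC G *m th) Dh.
rewrite beta mxE in b0 bi.
have zN0 : z != 0.
  apply: contraTneq a0 => z0; rewrite z0 oppr0 scale0r in DGth.
  by rewrite thE ctrM Dh -mulmxA -thE DGth mulmx0 mxE ltxx.
move: a0 ai b0 bi; case: (_ 0 0) => a b /= a0 -> ; case: z zN0 {Av DGth beta} => c d /=.
rewrite eq_complex /= !mulr0 subr0 add0r => zN0 ca /eqP.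
rewrite mulf_eq0 (gt_eqF a0) orbF oppr_eq0 => /eqP d0; rewrite d0 eqxx andbT in zN0.
by rewrite lt_neqAle zN0 -oppr_ge0 -(pmulr_lge0 _ a0).
Qed.

End AdaptationSpectrum.

(** * Caratheodory trajectories: calculus and increments *)

Section Increments.
Variable R : realType.
Local Notation mu := (@lebesgue_measure R).

Lemma mx_norm_leP (a b : nat) (A : 'M[R]_(a, b)) (B : R) : 0 <= B ->
  (forall i j, `|A i j| <= B) <-> `|A| <= B.
Proof.
have nA : `|A| = \big[Num.max/0]_ij `|A ij.1 ij.2| by exact: mx_normrE.
move=> B0; split=> [AB|]; rewrite nA.
  by apply: bigmax_le => // -[i j] _; exact: AB.
by move=> AB i j; apply: le_trans AB; exact: (le_bigmax _ (fun ij => `|A ij.1 ij.2|) (i, j)).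
Qed.

Lemma entry_le_mx_norm (a b : nat) (A : 'M[R]_(a, b)) i j : `|A i j| <= `|A|.
Proof. exact: (mx_norm_leP A (normr_ge0 A)).2. Qed.

Lemma mx_norm_mulmx (a b c : nat) (A : 'M[R]_(a, b)) (B : 'M[R]_(b, c)) :
  `|A *m B| <= b%:R * `|A| * `|B|.
Proof.
apply/mx_norm_leP => [|i j]; first by rewrite !mulr_ge0.
rewrite mxE; apply: le_trans (ler_norm_sum _ _ _) _.
apply: le_trans (_ : \sum_(l < b) `|A| * `|B| <= _).
  by apply: ler_sum => l _; rewrite normrM ler_pM ?entry_le_mx_norm.
by rewrite sumr_const card_ord -mulrA mulr_natl.
Qed.

Lemma ode_on_subset (J J' : set R) a b (z v : R -> 'M[R]_(a, b)) :
  J' `<=` J -> ode_on J z v -> ode_on J' z v.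
Proof. by move=> JJ' zv t /JJ'; exact: zv. Qed.

Lemma ode_onD (J : set R) a b (z1 v1 z2 v2 : R -> 'M[R]_(a, b)) :
  ode_on J z1 v1 -> ode_on J z2 v2 ->
  ode_on J (fun t => z1 t + z2 t) (fun t => v1 t + v2 t).
Proof.
move=> h1 h2 t Jt i j; have [i1 e1] := h1 t Jt i j; have [i2 e2] := h2 t Jt i j.
have eqv : (fun s => ((v1 s + v2 s) i j)%:E) =
    (fun s => (v1 s i j)%:E + (v2 s i j)%:E)%E.
  by apply/funext => s; rewrite mxE.
split; first by rewrite eqv; exact: integrableD.
rewrite !mxE e1 e2 addrACA -RintegralD //.
by under [X in _ = _ + X]eq_Rintegral do rewrite mxE.
Qed.

Lemma ode_onZ (J : set R) a b (c : R) (z v : R -> 'M[R]_(a, b)) :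
  ode_on J z v -> ode_on J (fun t => c *: z t) (fun t => c *: v t).
Proof.
move=> h t Jt i j; have [i1 e1] := h t Jt i j.
have eqv : (fun s => ((c *: v s) i j)%:E) = (fun s => c%:E * (v s i j)%:E)%E.
  by apply/funext => s; rewrite mxE.
split; first by rewrite eqv; exact: integrableZl.
rewrite !mxE e1 mulrDr -RintegralZl //.
by under [X in _ = _ + X]eq_Rintegral do rewrite mxE.
Qed.

Lemma ode_on_cst (J : set R) a b (c : 'M[R]_(a, b)) :
  ode_on J (fun=> c) (fun=> 0).
Proof.
move=> t Jt i j.
have c0 : (fun=> ((0 : 'M[R]_(a, b)) i j)%:E) = cst 0%E :> (R -> \bar R).
  by apply/funext => s; rewrite mxE.
by rewrite /Rintegral c0 integral0 addr0; split=> //; exact: integrable0.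
Qed.

Lemma ode_on_mull (J : set R) a b l (A : 'M[R]_(l, a)) (z v : R -> 'M[R]_(a, b)) :
  ode_on J z v -> ode_on J (fun t => A *m z t) (fun t => A *m v t).
Proof.
move=> h t Jt i j.
have sumR (r : seq 'I_a) :
    mu.-integrable `[0, t]%classic (fun s => (\sum_(l <- r) A i l * v s l j)%:E) /\
    \sum_(l <- r) A i l * z t l j = \sum_(l <- r) A i l * z 0 l j +
      \int[mu]_(s in `[0, t]%classic) \sum_(l <- r) A i l * v s l j.
  elim: r => [|l0 r [IHi IHe]].
    have v0 : (fun s => (\sum_(l <- [::]) A i l * v s l j)%:E) = cst 0%E.
      by apply/funext => s; rewrite big_nil.
    split; first by rewrite v0; exact: integrable0.
    rewrite !big_nil add0r.
    by under eq_Rintegral do rewrite big_nil; rewrite Rintegral_cst // mul0r.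
  have [i1 e1] := h t Jt l0 j.
  have i2 : mu.-integrable `[0, t]%classic (fun s => (A i l0 * v s l0 j)%:E).
    have -> : (fun s => (A i l0 * v s l0 j)%:E) =
      (fun s => (A i l0)%:E * (v s l0 j)%:E)%E by [].
    exact: integrableZl.
  split.
    have -> : (fun s => (\sum_(l <- l0 :: r) A i l * v s l j)%:E) =
        (fun s => (A i l0 * v s l0 j)%:E + (\sum_(l <- r) A i l * v s l j)%:E)%E.
      by apply/funext => s; rewrite big_cons.
    exact: integrableD.
  under [X in _ = _ + X]eq_Rintegral do rewrite big_cons.
  rewrite !big_cons IHe e1 RintegralD // RintegralZl // mulrDr.
  by rewrite addrACA.
have [hi he] := sumR (index_enum 'I_a); split.
  have -> // : (fun s => ((A *m v s) i j)%:E) = (fun s => (\sum_l A i l * v s l j)%:E).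
  by apply/funext => s; rewrite mxE.
rewrite !mxE he; congr (_ + _).
by apply: eq_Rintegral => s _; rewrite mxE.
Qed.

(** The only passage from integrals to estimates: every later argument works with
    increments of a trajectory and an almost-everywhere bound of its velocity. *)
Lemma ode_increment (J : set R) a b (z v : R -> 'M[R]_(a, b)) (c : 'M[R]_(a, b))
    (s t B : R) :
  ode_on J z v -> J s -> J t -> 0 <= s <= t -> 0 <= B ->
  {ae mu, forall u, s <= u <= t -> `|v u - c| <= B} ->
  `|z t - z s - (t - s) *: c| <= (t - s) * B.
Proof.
move=> zv Js Jt /andP[s0 st] B0 vB.
apply/mx_norm_leP => [|i j]; first by rewrite mulr_ge0 // subr_ge0.
have [ii ei] := zv t Jt i j; have [_ es] := zv s Js i j.
have mI : measurable `]s, t]%classic by exact: measurable_itv.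
have sub : `]s, t]%classic `<=` `[0, t]%classic.
  by move=> u /=; rewrite !in_itv /= => /andP[/ltW su ->]; rewrite (le_trans s0).
have fin : (mu `]s, t]%classic < +oo)%E.
  by rewrite lebesgue_measure_itv /=; case: ifP => _; rewrite ?ltry // -EFinB ltry.
have iv : mu.-integrable `]s, t]%classic (EFin \o (fun u => v u i j)).
  by apply: integrableS ii => //; exact: measurable_itv.
have ic r : mu.-integrable `]s, t]%classic (EFin \o (fun=> r : R)).
  apply/integrableP; split; first exact: measurable_cst.
  under eq_integral do rewrite abse_EFin.
  by rewrite integral_cst //= lte_mul_pinfty.
have lenI : fine (mu `]s, t]%classic) = t - s.
  rewrite lebesgue_measure_itv /=; case: ifP => //; rewrite lte_fin.
  by move=> /negbT; rewrite -leNgt => ts; apply/esym/eqP; rewrite subr_eq0 eq_le ts.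
have -> : (z t - z s - (t - s) *: c) i j =
    \int[mu]_(u in `]s, t]%classic) (v u i j - c i j).
  rewrite RintegralB // Rintegral_cst // lenI [c i j * _]mulrC !mxE; congr (_ - _).
  rewrite ei es opprD addrACA subrr add0r.
  by rewrite Rintegral_itvB.
have ivc : mu.-integrable `]s, t]%classic (EFin \o (fun u => v u i j - c i j)).
  have -> : EFin \o (fun u => v u i j - c i j) =
      ((EFin \o (fun u => v u i j)) \- (EFin \o (fun=> c i j)))%E.
    by apply/funext => u /=; rewrite EFinB.
  exact: integrableB.
apply: (le_trans (le_normr_Rintegral _ _)) => //.
have -> : (t - s) * B = fine (\int[mu]_(u in `]s, t]%classic) B%:E)%E.
  by rewrite integral_cst // fineM // ?lenI 1?mulrC // ge0_fin_numE.
have ivn := integrable_norm ivc.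
apply: fine_le.
- exact: integrable_fin_num.
- exact: integrable_fin_num (ic B).
apply: ae_ge0_le_integral => //.
- exact: measurable_int ivn.
move: vB; apply: (@filterS _ _ (ae_filter_ringOfSetsType mu)) => u vu.
rewrite /= in_itv /= => /andP[/ltW su ut]; have := vu; rewrite su ut => /(_ isT) h.
rewrite lee_fin; apply: le_trans h.
by have := entry_le_mx_norm (v u - c) i j; rewrite !mxE.
Qed.

End Increments.

(** * Continuity, measurability and uniqueness of trajectories *)

Section Regularity.
Variable R : realType.
Local Notation mu := (@lebesgue_measure R).

Lemma ode_continuous a b (z v : R -> 'M[R]_(a, b)) (t : R) i j : 0 <= t ->
  ode_on `[0, t]%classic z v -> {within `[0, t]%classic, continuous (fun s => z s i j)}.
Proof.
move=> t0 zv.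
have tt : `[0, t]%classic t by rewrite /= in_itv /= t0 lexx.
have [ii _] := zv t tt i j.
have cI := parameterized_integral_continuous t0 ii.
have cz : {within `[0, t]%classic, continuous
    (fun s => z 0 i j + \int[mu]_(u in `[0, s]%classic) v u i j)}.
  by move=> s; apply: cvgD; [exact: cvg_cst|exact: cI].
apply: subspace_eq_continuous cz => s /set_mem ts /=.
by have [_ e] := zv s ts i j; exact: (esym e).
Qed.

Lemma ode_locally_bounded a b (z v : R -> 'M[R]_(a, b)) (t : R) : 0 <= t ->
  ode_on `[0, t]%classic z v ->
  exists2 S, 0 <= S & forall s, 0 <= s <= t -> `|z s| <= S.
Proof.
move=> t0 zv.
have /choice[F FP] : forall ij : 'I_a * 'I_b, exists B, 0 <= B /\
    forall s, 0 <= s <= t -> `|z s ij.1 ij.2| <= B.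
  move=> [i j] /=; have cz := @ode_continuous _ _ _ _ _ i j t0 zv.
  have [c1 _ h1] := EVT_max t0 cz; have [c2 _ h2] := EVT_min t0 cz.
  exists (`|z c1 i j| + `|z c2 i j|); split=> [|s st]; first by rewrite addr_ge0.
  have st' : s \in `[0, t] by rewrite in_itv.
  rewrite ler_norml; have := h1 s st'; have := h2 s st'.
  have := ler_norm (z c1 i j); have := lerNnormlW (lexx `|z c2 i j|).
  have := normr_ge0 (z c1 i j); have := normr_ge0 (z c2 i j); lra.
exists (\sum_ij F ij); first by apply: sumr_ge0 => ij _; exact: (FP ij).1.
move=> s st; apply/mx_norm_leP => [|i j].
  by apply: sumr_ge0 => ij _; exact: (FP ij).1.
rewrite (bigD1 (i, j)) //=; apply: le_trans ((FP (i, j)).2 s st) _.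
by rewrite lerDl; apply: sumr_ge0 => ij _; exact: (FP ij).1.
Qed.

Lemma ode_measurable a b (z v : R -> 'M[R]_(a, b)) (i : 'I_a) (j : 'I_b) :
  ode_on `[0, +oo[%classic z v ->
  measurable_fun (`[0, +oo[%classic : set R) (fun s => z s i j).
Proof.
move=> zv; have -> : `[0, +oo[%classic = \bigcup_k `[0, k%:R]%classic :> set R.
  by rewrite itv_bndy_bigcup_BRight; apply: eq_bigcupr => k _; rewrite add0r.
apply/measurable_fun_bigcup => [k|k]; first exact: measurable_itv.
apply: measurable_realfun.subspace_continuous_measurable_fun; first exact: measurable_itv.
apply: ode_continuous => //; apply: ode_on_subset zv => s /=.
by rewrite !in_itv /= => /andP[->].
Qed.

(** A Gronwall bound on an interval so short that the supremum S of |z| satisfies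
    S <= |z t| + S / 2 + h b, and can be absorbed on the left.  An a priori finite
    bound S0 makes S meaningful. *)
Lemma ode_short_step (J : set R) k l (z v : R -> 'M[R]_(k, l)) (a b t h S0 : R) :
  ode_on J z v -> 0 <= t -> 0 <= h -> 0 <= a -> 0 <= b -> h * a <= 1 / 2 ->
  (forall u, t <= u <= t + h -> J u) ->
  (forall u, t <= u <= t + h -> `|z u| <= S0) ->
  {ae mu, forall u, t <= u <= t + h -> `|v u| <= a * `|z u| + b} ->
  forall u, t <= u <= t + h -> `|z u| <= 2 * `|z t| + 2 * h * b.
Proof.
move=> zv t0 h0 a0 b0 ha Jt zS0 vb.
have tJ : t <= t <= t + h by rewrite lexx lerDl.
pose E : set R := [set x | exists2 u, t <= u <= t + h & x = `|z u|].
have supE : has_sup E.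
  split; first by exists `|z t|, t.
  by exists S0 => _ [u tu ->]; exact: zS0.
have leS u : t <= u <= t + h -> `|z u| <= sup E.
  by move=> tu; apply: ub_le_sup; [exact: supE.2|exists u].
have S_ge0 : 0 <= sup E by apply: le_trans (leS t tJ).
have step u : t <= u <= t + h -> `|z u| <= `|z t| + sup E / 2 + h * b.
  move=> tu; have /andP[tu1 tu2] := tu.
  have : `|z u - z t - (u - t) *: 0| <= (u - t) * (a * sup E + b).
    apply: (ode_increment zv) => //; [exact: Jt|exact: Jt|by rewrite t0|nra|].
    move: vb; apply: (@filterS _ _ (ae_filter_ringOfSetsType mu)) => s vs /andP[ts su].
    have ts' : t <= s <= t + h by rewrite ts (le_trans su).
    rewrite subr0; apply: le_trans (vs ts') _.
    by rewrite lerD2r ler_wpM2l // leS.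
  rewrite scaler0 subr0 => dz.
  have : `|z u| <= `|z t| + `|z u - z t|.
    by apply: le_trans (ler_normD _ _); rewrite addrC subrK.
  have : (u - t) * (a * sup E + b) <= h * (a * sup E + b).
    by apply: ler_wpM2r; [nra|lra].
  have : h * a * sup E <= 1 / 2 * sup E by rewrite ler_wpM2r.
  by lra.
have : sup E <= `|z t| + sup E / 2 + h * b.
  by apply: ge_sup => [|_ [u tu ->]]; [exists `|z t|, t|exact: step].
by move=> SE u /leS uS; lra.
Qed.

Lemma ode_unique k l (z v : R -> 'M[R]_(k, l)) (a T : R) : 0 <= a ->
  ode_on `[0, T]%classic z v -> z 0 = 0 ->
  (forall u, 0 <= u <= T -> `|v u| <= a * `|z u|) ->
  forall u, 0 <= u <= T -> z u = 0.
Proof.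
move=> a0 zv z0 va u /andP[u0 uT].
have T0 : 0 <= T := le_trans u0 uT.
have [S S0 zS] := ode_locally_bounded T0 zv.
pose h := (2 * (a + 1))^-1.
have h0 : 0 < h by rewrite invr_gt0; lra.
have ha : h * a <= 1 / 2.
  by rewrite mulrC ler_pdivrMr; lra.
have steps n : forall s, 0 <= s <= T -> s <= n%:R * h -> z s = 0.
  elim: n => [|n IH] s /andP[s0 sT].
    by rewrite mul0r => s0'; have -> : s = 0 by apply/eqP; rewrite eq_le s0 s0'.
  rewrite -natr1 mulrDl mul1r => sn.
  have [ns|ns] := leP s (n%:R * h); first by rewrite IH // s0.
  have t0 : 0 <= n%:R * h by rewrite mulr_ge0 // ltW.
  have zt : z (n%:R * h) = 0 by apply: IH => //; rewrite t0 (le_trans (ltW ns)).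
  pose h' := s - n%:R * h.
  have h'0 : 0 <= h' by rewrite subr_ge0 ltW.
  have eh : n%:R * h + h' = s by rewrite /h' addrC subrK.
  have h'h : h' <= h by rewrite lerBlDl.
  have := @ode_short_step _ _ _ _ _ a 0 (n%:R * h) h' S zv t0 h'0 a0 (lexx _).
  rewrite eh zt normr0 !mulr0 addr0 => K.
  suff : `|z s| <= 0 by rewrite normr_le0 => /eqP.
  apply: K; last by rewrite (ltW ns) lexx.
  - by apply: le_trans ha; rewrite ler_wpM2r.
  - by move=> x /andP[x1 x2]; rewrite /= in_itv /= (le_trans t0) // (le_trans x2).
  - by move=> x /andP[x1 x2]; apply: zS; rewrite (le_trans t0) // (le_trans x2).
  apply: aeW => x /andP[x1 x2]; rewrite addr0; apply: va.
  by rewrite (le_trans t0) // (le_trans x2).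
apply: (steps (Num.truncn (u / h)).+1); first by rewrite u0.
by rewrite -ler_pdivrMr // ltW // truncnS_gt.
Qed.

End Regularity.

(** * One Euler step in the contracting norm *)

Section EulerStep.
Variable R : realType.
Local Notation mu := (@lebesgue_measure R).

Lemma ode_exp a b (rho : R) (c : 'M[R]_(a, b)) :
  ode_on `[0, +oo[%classic (fun t => expR (- (rho * t)) *: c)
    (fun t => - rho *: (expR (- (rho * t)) *: c)).
Proof.
pose F (t : R) := expR (- (rho * t)); pose f (t : R) := - rho * expR (- (rho * t)).
have cF : continuous F.
  move=> t; apply: continuous_comp; last exact: continuous_expR.
  by apply: cvgN; apply: cvgM; [exact: cvg_cst|exact: cvg_id].
have cf : continuous f by move=> t; apply: cvgM; [exact: cvg_cst|exact: cF].
have F' z : derivable F z 1 /\ (F^`())%classic z = f z.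
  have dF : is_derive z (1 : R) F (f z).
    by apply: is_derive_eq; rewrite /f mulrC [_%:A]mulr1.
  by split; [exact: ex_derive|rewrite derive1E derive_val].
have iF t : 0 <= t -> mu.-integrable `[0, t]%classic (EFin \o f) /\
    \int[mu]_(s in `[0, t]%classic) f s = F t - F 0.
  move=> t0; split.
    apply: continuous_compact_integrable; first exact: segment_compact.
    exact: continuous_subspaceT.
  move: t0; rewrite le_eqVlt => /predU1P[<-|t0].
    by rewrite set_itv1 Rintegral_set1 subrr.
  rewrite /Rintegral (@continuous_FTC2 _ _ F) //.
  - exact: continuous_subspaceT.
  - split=> [z _||]; first exact: (F' z).1.
      by apply/cvg_at_right_filter; exact: cF.
    by apply/cvg_at_left_filter; exact: cF.
  - by move=> z _; exact: (F' z).2.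
move=> t; rewrite /= in_itv /= andbT => t0 i j.
have [ii ei] := iF t t0.
have vE s : (- rho *: (expR (- (rho * s)) *: c)) i j = c i j * f s.
  by rewrite !mxE /f; ring.
have -> : (fun s => ((- rho *: (expR (- (rho * s)) *: c)) i j)%:E) =
    (fun s => (c i j)%:E * (f s)%:E)%E.
  by apply/funext => s; rewrite vE.
split; first exact: integrableZl.
under eq_Rintegral do rewrite vE.
rewrite RintegralZl // ei /F !mxE; ring.
Qed.

(** [contracting_norm] for real vectors, with L >= 1 and d <= 1 for convenience in
    the estimates below. *)
Lemma euler_norm k (A : 'M[R]_k) : stable_spectrum (toC A) ->
  exists (N : 'cV[R]_k -> R) (L d : R), [/\ 1 <= L, 0 < d <= 1,
    forall u v, N (u + v) <= N u + N v,
    forall u, N u <= L * `|u| /\ `|u| <= L * N u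
  & forall h u, 0 <= h <= d -> N (u + h *: (A *m u)) <= (1 - d * h) * N u].
Proof.
move=> /contracting_norm[nrm [K [d [K0 d0 [nD _ nK Kn nA]]]]].
have vn u : `|u| <= vnorm1 (toC u) /\ vnorm1 (toC u) <= k%:R * `|u : 'cV[R]_k|.
  have vE : vnorm1 (toC u) = \sum_i `|u i 0|.
    by apply: eq_bigr => i _; rewrite mxE normc_real.
  rewrite vE; split.
    apply/mx_norm_leP => [|i j]; first exact: sumr_ge0.
    by rewrite ord1 (bigD1 i) //= lerDl; apply: sumr_ge0.
  apply: le_trans (_ : \sum_(i < k) `|u| <= _); last first.
    by rewrite sumr_const card_ord mulr_natl.
  by apply: ler_sum => i _; exact: entry_le_mx_norm.
exists (fun u => nrm (toC u)), (1 + K + K * k%:R), (Num.min d 1).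
have Kk : 0 <= K * k%:R by rewrite mulr_ge0 // ltW.
have N0 u : 0 <= nrm (toC u).
  rewrite -(pmulr_rge0 _ K0); apply: le_trans (Kn _); exact: vnorm1_ge0.
split.
- by lra.
- by rewrite lt_min d0 ltr01 ge_min lexx orbT.
- by move=> u v; rewrite /toC map_mxD; exact: nD.
- move=> u; split.
    apply: le_trans (nK _) _; apply: le_trans (ler_wpM2l (ltW K0) (vn u).2) _.
    by rewrite mulrA ler_wpM2r //; lra.
  apply: le_trans (vn u).1 (le_trans (Kn _) _).
  by rewrite ler_wpM2r //; lra.
move=> h u /andP[h0 hd].
have -> : toC (u + h *: (A *m u)) = toC u + h%:C%C *: (toC A *m toC u).
  by rewrite /toC map_mxD map_mxZ map_mxM.
apply: le_trans (nA h _ _) _.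
  by rewrite h0 (le_trans hd) // ge_min lexx.
apply: ler_wpM2r => //; rewrite lerD2l lerN2 ler_wpM2r //.
by rewrite ge_min lexx.
Qed.

(** Over one step of length h the trajectory differs from the Euler step
    x + h A x by O(h^2) |x| from the drift of x, h e |x| from the perturbation and
    O(h) b from the forcing; for e and h small, these leave half of the rate d. *)
Lemma stable_step k (A : 'M[R]_k) : stable_spectrum (toC A) ->
  exists (N : 'cV[R]_k -> R) (L d e h : R), [/\ 1 <= L, 0 < d <= 1, 0 < e, 0 < h <= 1
    & (forall u, N u <= L * `|u| /\ `|u| <= L * N u) /\
    forall (x v : R -> 'cV[R]_k) (t b : R), 0 <= t -> 0 <= b ->
    ode_on `[0, +oo[%classic x v ->
    {ae mu, forall u, t <= u -> `|v u - A *m x u| <= e * `|x u| + b} ->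
    N (x (t + h)) <= (1 - h * d / 2) * N (x t) + 4 * L * h * b /\
    forall s, t <= s <= t + h -> `|x s| <= 2 * `|x t| + 2 * b].
Proof.
move=> /euler_norm[N [L [d [L1 d01 ND NL NA]]]]; have /andP[d0 d1] := d01.
pose a := k%:R * `|A|; have a0 : 0 <= a by rewrite mulr_ge0.
have Aa (u : 'cV[R]_k) : `|A *m u| <= a * `|u| by exact: mx_norm_mulmx.
have L2 : 0 < 8 * L ^+ 2 by rewrite mulr_gt0 // exprn_gt0 // (lt_le_trans ltr01).
(* e bounds the relative error of the perturbation and, through the choice of h,
   that of the drift; together they must cost at most d / 2 *)
pose e := Num.min (1 / 2) (d / (8 * L ^+ 2)).
have e0 : 0 < e by rewrite lt_min !divr_gt0.
have e1 : e <= 1 / 2 by rewrite ge_min lexx.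
have eL : e * (8 * L ^+ 2) <= d.
  by rewrite -ler_pdivlMr // ge_min lexx orbT.
have a2 : 0 < (a + 1) ^+ 2 by rewrite exprn_gt0 //; lra.
pose h := Num.min d (e / (a + 1) ^+ 2).
have h0 : 0 < h by rewrite lt_min d0 divr_gt0.
have hd : h <= d by rewrite ge_min lexx.
have ha : h * (a + 1) ^+ 2 <= e.
  by rewrite -ler_pdivlMr // ge_min lexx orbT.
have ha1 : h * (a + 1) <= 1 / 2.
  apply: le_trans e1; apply: le_trans ha.
  by rewrite ler_wpM2l ?(ltW h0) // expr2 ler_peMr; lra.
have haa : a * (a + 1) * h <= e.
  by apply: le_trans ha; rewrite mulrC ler_wpM2l ?(ltW h0) // expr2 ler_wpM2r; lra.
exists N, L, d, e, h; split=> //; first by rewrite h0 (le_trans hd).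
split=> // x v t b t0 b0 xv vb.
have [S0 S0_ge0 xS0] : exists2 S, 0 <= S & forall s, 0 <= s <= t + h -> `|x s| <= S.
  apply: (@ode_locally_bounded _ _ _ x v); first by rewrite addr_ge0 // ltW.
  by apply: ode_on_subset xv => s /=; rewrite !in_itv /= => /andP[->].
have Jt u : t <= u <= t + h -> `[0, +oo[%classic u.
  by move=> /andP[tu _]; rewrite /= in_itv /= andbT (le_trans t0).
have vb' : {ae mu, forall u, t <= u <= t + h -> `|v u| <= (a + 1) * `|x u| + b}.
  move: vb; apply: (@filterS _ _ (ae_filter_ringOfSetsType mu)) => u vu /andP[/vu tu _].
  have : `|v u| <= `|v u - A *m x u| + `|A *m x u|.
    by apply: le_trans (ler_normD _ _); rewrite subrK.
  have := Aa (x u); have := normr_ge0 (x u); nra.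
have short : forall s, t <= s <= t + h -> `|x s| <= 2 * `|x t| + 2 * h * b.
  apply: (ode_short_step xv t0 (ltW h0) _ b0 ha1 Jt _ vb'); first lra.
  by move=> u /andP[tu uh]; apply: xS0; rewrite (le_trans t0).
have nx := normr_ge0 (x t).
split; last by move=> s /short; nra.
set S := 2 * `|x t| + 2 * h * b in short.
have S_ge0 : 0 <= S by rewrite /S; nra.
have drift s : t <= s <= t + h -> `|x s - x t| <= h * ((a + 1) * S + b).
  move=> ts; have /andP[ts1 ts2] := ts.
  have : `|x s - x t - (s - t) *: 0| <= (s - t) * ((a + 1) * S + b).
    apply: (ode_increment xv); [by apply: Jt; rewrite lexx; lra|exact: Jt|by rewrite t0|nra|].
    move: vb'; apply: (@filterS _ _ (ae_filter_ringOfSetsType mu)) => u vu /andP[tu us].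
    have tuh : t <= u <= t + h by rewrite tu (le_trans us).
    rewrite subr0; apply: le_trans (vu tuh) _.
    by rewrite lerD2r ler_wpM2l ?short //; lra.
  rewrite scaler0 subr0 => xs; apply: le_trans xs _.
  by apply: ler_wpM2r; [nra|lra].
pose B := e * S + b + a * (h * ((a + 1) * S + b)).
have B_ge0 : 0 <= B.
  have aS : 0 <= (a + 1) * S by rewrite mulr_ge0 //; lra.
  have q1 : 0 <= h * ((a + 1) * S + b) by rewrite mulr_ge0 ?(ltW h0) ?addr_ge0.
  by rewrite /B !addr_ge0 // mulr_ge0 // ltW.
have euler : `|x (t + h) - x t - h *: (A *m x t)| <= h * B.
  have -> : h = (t + h) - t by rewrite addrC addKr.
  have tth : t <= t + h by lra.
  rewrite [in x (_ + _)](_ : t + (t + h - t) = t + h); last by rewrite addrC subrK.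
  apply: (ode_increment xv);
    [by apply: Jt; rewrite lexx|by apply: Jt; rewrite lexx tth|by rewrite t0| |].
    exact: B_ge0.
  move: vb; apply: (@filterS _ _ (ae_filter_ringOfSetsType mu)) => u vu tuh.
  have /andP[/vu tu _] := tuh.
  have : `|v u - A *m x t| <= `|v u - A *m x u| + `|A *m (x u - x t)|.
    by apply: le_trans (ler_normD _ _); rewrite mulmxBr addrA subrK.
  have := Aa (x u - x t); have := ler_wpM2l a0 (drift u tuh).
  have := ler_wpM2l (ltW e0) (short u tuh); rewrite /B; lra.
have N0 := (NL (x t)).2.
have BN : B <= 4 * e * `|x t| + 4 * b.
  have : B = (e + a * (a + 1) * h) * S + (1 + a * h) * b by rewrite /B; ring.
  have : (e + a * (a + 1) * h) * S <= (2 * e) * S by apply: ler_wpM2r => //; lra.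
  have ah : a * h <= 1 / 2 by lra.
  have h1 : h <= 1 by lra.
  have hb : 0 <= h * b by rewrite mulr_ge0 // ltW.
  have := ler_wpM2r b0 ah; have := ler_wpM2r b0 h1; have := ler_wpM2r hb e1.
  rewrite /S; lra.
have hB := ler_wpM2l (ltW h0) BN.
have Nx : N (x (t + h)) <= (1 - d * h) * N (x t) + L * (h * B).
  have -> : x (t + h) = (x t + h *: (A *m x t)) + (x (t + h) - x t - h *: (A *m x t)).
    by rewrite -[x (t + h) - x t - _]addrA -opprD [RHS]addrC subrK.
  apply: le_trans (ND _ _) _; apply: lerD; first by apply: NA; rewrite (ltW h0).
  by apply: le_trans (NL _).1 _; rewrite ler_wpM2l //; lra.
have NN : 0 <= N (x t).
  by rewrite -(pmulr_rge0 _ (lt_le_trans ltr01 L1)) (le_trans nx).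
have LB : L * (h * B) <= L * (h * (4 * e * `|x t| + 4 * b)).
  by apply: ler_wpM2l => //; lra.
have LN : L * (h * (4 * e * `|x t|)) <= h * d / 2 * N (x t).
  have : L * (h * (4 * e * `|x t|)) <= L * (h * (4 * e * (L * N (x t)))).
    by rewrite !ler_wpM2l //; nra.
  have : h * (e * (8 * L ^+ 2)) * N (x t) <= h * d * N (x t).
    by rewrite ler_wpM2r // ler_wpM2l // ltW.
  lra.
lra.
Qed.

End EulerStep.

(** * Boundedness and decay of perturbed stable systems *)

Section StableTracking.
Variable R : realType.
Local Notation mu := (@lebesgue_measure R).

(** Iterating [stable_step] gives a geometric sequence plus a multiple of b; between
    grid points the trajectory stays comparable to its last grid value.  Taking
    n = 0 yields boundedness, and n large with b small yields decay. *)
Lemma stable_tracking k (A : 'M[R]_k) : stable_spectrum (toC A) ->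
  exists e K h q : R, [/\ 0 < e, 0 <= K, 0 < h, 0 <= q < 1
    & forall (x v : R -> 'cV[R]_k) (t0 b : R), 0 <= t0 -> 0 <= b ->
      ode_on `[0, +oo[%classic x v ->
      {ae mu, forall u, t0 <= u -> `|v u - A *m x u| <= e * `|x u| + b} ->
      forall n t, t0 + n%:R * h <= t -> `|x t| <= K * (q ^+ n * `|x t0| + b)].
Proof.
move=> /stable_step[N [L [d [e [h [L1 /andP[d0 d1] e0 /andP[h0 h1] [NL step]]]]]]].
pose q := 1 - h * d / 2.
have hd0 : 0 < h * d by rewrite mulr_gt0.
have hd1 : h * d <= 1 by rewrite mulr_ile1 // ltW.
have q0 : 0 <= q by rewrite /q; lra.
have q1 : q < 1 by rewrite /q; lra.
have L0 : 0 <= L by lra.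
pose K := 2 * L ^+ 2 + 16 * L ^+ 2 / d + 2.
have L20 : 0 <= L ^+ 2 by exact: exprn_ge0.
have Ld0 : 0 <= L ^+ 2 / d by rewrite divr_ge0 // ltW.
exists e, K, h, q; split=> //; first by rewrite /K; lra.
  by rewrite q0.
move=> x v t0 b t00 b0 xv vb n t nt.
have t0j j : 0 <= t0 + j%:R * h by rewrite addr_ge0 // mulr_ge0 // ltW.
have vbj j : {ae mu, forall u, t0 + j%:R * h <= u -> `|v u - A *m x u| <= e * `|x u| + b}.
  move: vb; apply: (@filterS _ _ (ae_filter_ringOfSetsType mu)) => u vu ju.
  by apply: vu; apply: le_trans ju; rewrite lerDl mulr_ge0 // ltW.
have dec j : N (x (t0 + j%:R * h)) <= q ^+ j * N (x t0) + 8 * L / d * b.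
  elim: j => [|j IH].
    by rewrite mul0r addr0 expr0 mul1r lerDl mulr_ge0 // divr_ge0 ?mulr_ge0 // ltW.
  have [+ _] := step x v _ b (t0j j) b0 xv (vbj j).
  rewrite -addrA -{2}[h]mul1r -mulrDl natr1 -/q => H.
  apply: le_trans H _; apply: le_trans (lerD (ler_wpM2l q0 IH) (lexx _)) _.
  rewrite mulrDr mulrA -exprS -addrA lerD2l.
  have -> : q * (8 * L / d * b) = 8 * L / d * b - 4 * L * h * b.
    by rewrite /q; field; rewrite gt_eqF.
  by rewrite subrK.
pose j := Num.truncn ((t - t0) / h).
have t0t : t0 <= t by apply: le_trans nt; rewrite lerDl mulr_ge0 // ltW.
have /andP[j1 j2] : j%:R <= (t - t0) / h < j.+1%:R.
  by apply: truncn_itv; rewrite divr_ge0 ?subr_ge0 // ltW.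
have jt : t0 + j%:R * h <= t <= t0 + j%:R * h + h.
  rewrite ler_pdivlMr // in j1; rewrite ltr_pdivrMr // -natr1 in j2.
  by apply/andP; split; lra.
have nj : (n <= j)%N.
  rewrite -ltnS -(ltr_nat R); apply: le_lt_trans j2.
  by rewrite ler_pdivlMr //; lra.
have [_ /(_ t jt) xt] := step x v _ b (t0j j) b0 xv (vbj j).
apply: le_trans xt _.
have xN : `|x (t0 + j%:R * h)| <= L * (q ^+ n * (L * `|x t0|) + 8 * L / d * b).
  apply: le_trans (NL _).2 _; rewrite ler_wpM2l //; apply: le_trans (dec j) _.
  rewrite lerD2r; have N0 : 0 <= N (x t0).
    by rewrite -(pmulr_rge0 _ (lt_le_trans ltr01 L1)) (le_trans _ (NL _).2).
  apply: le_trans (_ : q ^+ n * N (x t0) <= _).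
    by apply: ler_wpM2r => //; apply: ler_wiXn2l => //; exact: ltW.
  by rewrite ler_wpM2l ?exprn_ge0 // (NL _).1.
have qx : 0 <= q ^+ n * `|x t0| by rewrite mulr_ge0 ?exprn_ge0.
have e1 : L * (q ^+ n * (L * `|x t0|) + 8 * L / d * b) =
  L ^+ 2 * (q ^+ n * `|x t0|) + 8 * (L ^+ 2 / d) * b by ring.
rewrite e1 in xN; rewrite /K.
have : 0 <= L ^+ 2 / d * (q ^+ n * `|x t0|) by rewrite mulr_ge0.
have : 0 <= L ^+ 2 * b by rewrite mulr_ge0.
rewrite -[16 * _ / d]mulrA; lra.
Qed.

Lemma expn_small (q e : R) : 0 <= q < 1 -> 0 < e -> exists n, q ^+ n <= e.
Proof.
move=> /andP[q0 q1] e0.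
have : (q ^+ n @[n --> \oo] --> (0 : R)) by apply: cvg_expr; rewrite ger0_norm.
move=> /cvgr_lt/(_ _ e0)[n _ /(_ n (leqnn n))] /= qn.
by exists n; exact: ltW.
Qed.

Lemma stable_bounded k (A : 'M[R]_k) : stable_spectrum (toC A) ->
  exists2 e, 0 < e & forall (x v : R -> 'cV[R]_k) (t0 b : R), 0 <= t0 -> 0 <= b ->
    ode_on `[0, +oo[%classic x v ->
    {ae mu, forall u, t0 <= u -> `|v u - A *m x u| <= e * `|x u| + b} ->
    exists2 S, 0 <= S & forall t, 0 <= t -> `|x t| <= S.
Proof.
move=> /stable_tracking[e [K [h [q [e0 K0 h0 _ track]]]]].
exists e => // x v t0 b t00 b0 xv vb.
have [S S0 xS] : exists2 S, 0 <= S & forall s, 0 <= s <= t0 -> `|x s| <= S.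
  apply: (ode_locally_bounded t00 (v := v)); apply: ode_on_subset xv => s /=.
  by rewrite !in_itv /= => /andP[->].
exists (S + K * (`|x t0| + b)); first by rewrite addr_ge0 // mulr_ge0 // addr_ge0.
move=> t t_ge0; have [tt0|t0t] := leP t t0.
  apply: le_trans (xS t _) _; first by rewrite t_ge0.
  by rewrite lerDl mulr_ge0 // addr_ge0.
have := track x v t0 b t00 b0 xv vb 0%N t; rewrite mul0r addr0 expr0 mul1r.
by move=> /(_ (ltW t0t)) H; apply: le_trans H _; rewrite lerDr.
Qed.

Lemma stable_vanishing k (A : 'M[R]_k) (x v : R -> 'cV[R]_k) :
  stable_spectrum (toC A) -> ode_on `[0, +oo[%classic x v ->
  (forall b, 0 < b -> exists2 t0, 0 <= t0 &
     {ae mu, forall u, t0 <= u -> `|v u - A *m x u| <= b}) ->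
  forall b, 0 < b -> exists2 t0, 0 <= t0 & forall t, t0 <= t -> `|x t| <= b.
Proof.
move=> /stable_tracking[e [K [h [q [e0 K0 h0 q01 track]]]]] xv vb b b0.
pose c := b / (2 * (K + 1)).
have c0 : 0 < c by rewrite divr_gt0 //; lra.
have cE : c * (2 * (K + 1)) = b by rewrite /c divfK // gt_eqF //; lra.
have [t0 t00 vc] := vb c c0.
have [n qn] : exists n, q ^+ n <= c / (`|x t0| + 1).
  by apply: expn_small => //; rewrite divr_gt0 // ltr_wpDl.
exists (t0 + n%:R * h); first by rewrite addr_ge0 // mulr_ge0 // ltW.
move=> t nt.
have vc' : {ae mu, forall u, t0 <= u -> `|v u - A *m x u| <= e * `|x u| + c}.
  move: vc; apply: (@filterS _ _ (ae_filter_ringOfSetsType mu)) => u vu /vu H.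
  by apply: le_trans H _; rewrite lerDr mulr_ge0 // ltW.
have := track x v t0 c t00 (ltW c0) xv vc' n t nt => H; apply: le_trans H _.
have x0 := normr_ge0 (x t0).
rewrite ler_pdivlMr in qn; last by rewrite ltr_wpDl.
have qn0 : 0 <= q ^+ n by apply: exprn_ge0; case/andP: q01.
have : q ^+ n * `|x t0| + c <= 2 * c by lra.
move=> /(ler_wpM2l K0); lra.
Qed.

End StableTracking.

(** * Filtered data and their averages *)

Section FilteredData.
Variable R : realType.

Lemma sub_itv0y (t : R) : `[0, t]%classic `<=` (`[0, +oo[%classic : set R).
Proof. by move=> s /=; rewrite !in_itv /= => /andP[->]. Qed.

(** The defect of the identity starts at 0 and decays at rate rho, both the filters
    and exp (- rho t) x(0) being modes of the same first-order dynamics; by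
    uniqueness it vanishes. *)
Lemma filter_identity (n m q : nat) (A : 'M[R]_n) (B : 'M[R]_(n, m)) (E : 'M[R]_(n, q))
    (rho : R) (J : set R) u x w uf xf wf (T : R) :
  0 <= rho -> filtered_trajectory A B E rho J u x w uf xf wf -> `[0, T]%classic `<=` J ->
  forall t, 0 <= t <= T ->
  xdf rho x xf t = A *m xf t + B *m uf t + E *m wf t.
Proof.
move=> rho0 [hx _ [uf0 huf] [xf0 hxf] [wf0 hwf]] TJ t tT.
have sub := ode_on_subset TJ.
have hexp := ode_on_subset (@sub_itv0y T) (ode_exp rho (x 0)).
pose y s := x s + (-1) *: (expR (- (rho * s)) *: x 0) + (- rho) *: xf s
  + (-1) *: (A *m xf s) + (-1) *: (B *m uf s) + (-1) *: (E *m wf s).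
have hy := ode_onD (ode_onD (ode_onD (ode_onD (ode_onD (sub _ _ _ _ hx)
  (ode_onZ (-1) hexp)) (ode_onZ (- rho) (sub _ _ _ _ hxf)))
  (ode_onZ (-1) (ode_on_mull A (sub _ _ _ _ hxf))))
  (ode_onZ (-1) (ode_on_mull B (sub _ _ _ _ huf))))
  (ode_onZ (-1) (ode_on_mull E (sub _ _ _ _ hwf))).
have y0 : y 0 = 0.
  rewrite /y xf0 uf0 wf0 mulr0 oppr0 expR0 !mulmx0 !scaler0 !addr0 scale1r scaleN1r.
  exact: subrr.
have yt : y t = 0.
  apply: (ode_unique rho0 hy y0 _ tT) => s _.
  set v := (X in `|X| <= _); have -> : v = - rho *: y s.
    rewrite /v /y !mulmxDr -!scalemxAr.
    move: (x s) (xf s) (A *m _) (A *m _) (B *m _) (B *m _) (E *m _) (E *m _).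
    move=> a b c d e f g h; apply/colP => i; rewrite !mxE; ring.
  by rewrite normrZ normrN (ger0_norm rho0).
apply/eqP; rewrite -subr_eq0 -yt /y /xdf; apply/eqP.
by apply/colP => i; rewrite !mxE; ring.
Qed.

Lemma running_averageE (a b N : nat) (S0 : 'M[R]_(a, b)) (inc : nat -> 'M[R]_(a, b)) j :
  (0 < N)%N ->
  running_average N S0 inc j =
    (N + j)%:R^-1 *: (N%:R *: S0 + \sum_(l < j) inc l.+1).
Proof.
move=> N0; elim: j => [|j IH].
  by rewrite big_ord0 addr0 addn0 scalerA mulVf ?scale1r // pnatr_eq0 -lt0n.
rewrite /= IH big_ord_recr /= addnS subn1 /= scalerA.
have -> : (N + j)%:R / (N + j).+1%:R / (N + j)%:R = (N + j).+1%:R^-1 :> R.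
  by rewrite mulrAC divff ?mul1r // pnatr_eq0 addn_eq0 negb_and -lt0n N0.
by rewrite -scalerDr addrA.
Qed.

Lemma snapshots_mulT (a b N : nat) (y : R -> 'cV[R]_a) (z : R -> 'cV[R]_b)
    (tau : 'I_N -> R) :
  snapshots y tau *m (snapshots z tau)^T = \sum_(l < N) y (tau l) *m (z (tau l))^T.
Proof.
apply/matrixP => i j; rewrite mxE summxE; apply: eq_bigr => l _.
by rewrite !mxE big_ord1 !mxE.
Qed.

Lemma snapshots_col_mx (a b N : nat) (y : R -> 'cV[R]_a) (z : R -> 'cV[R]_b)
    (tau : 'I_N -> R) :
  col_mx (snapshots y tau) (snapshots z tau) =
    snapshots (fun t => col_mx (y t) (z t)) tau.
Proof.
by apply/matrixP => i j; rewrite !mxE; case: (fintype.split i) => l; rewrite !mxE.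
Qed.

(** Unfolding the recursion puts offline and online samples on the same footing,
    which turns the signals into Gram-type products of the extended data. *)
Lemma running_average_gram (a b N M : nat) (V : 'M[R]_(a, N)) (Z : 'M[R]_(b, N))
    (y : R -> 'cV[R]_a) (z : R -> 'cV[R]_b) (ts : nat -> R) : (0 < N)%N ->
  running_average N (N%:R^-1 *: (V *m Z^T)) (fun j => y (ts j) *m (z (ts j))^T) M =
  (N + M)%:R^-1 *: (row_mx V (snapshots y (fun j : 'I_M => ts j.+1)) *m
    (row_mx Z (snapshots z (fun j : 'I_M => ts j.+1)))^T).
Proof.
move=> N0; rewrite running_averageE // scalerA divff ?scale1r ?pnatr_eq0 -?lt0n //.
by rewrite tr_row_mx mul_row_col snapshots_mulT.
Qed.

Lemma gram_eq0 (a b : nat) (A : 'M[R]_(a, b)) : A^T *m A = 0 -> A = 0.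
Proof.
move=> AA; apply/matrixP => i j; rewrite mxE.
have /eqP : (A^T *m A) j j = 0 by rewrite AA mxE.
rewrite mxE psumr_eq0 => [|l _]; last by rewrite mxE -expr2 sqr_ge0.
by move=> /allP/(_ i (mem_index_enum _)); rewrite mxE -expr2 sqrf_eq0 => /eqP.
Qed.

(** Z^T and Z Z^T have the same row space: a vector killed by Z Z^T is killed by
    Z^T, because its image under Z^T has norm 0. *)
Lemma gram_factor (a b c : nat) (V : 'M[R]_(a, b)) (Z : 'M[R]_(c, b)) :
  exists Y : 'M[R]_(a, c), V *m Z^T = Y *m (Z *m Z^T).
Proof.
apply/submxP; apply: submx_trans (submxMl V Z^T) _.
rewrite submxE; apply/eqP; apply: gram_eq0.
by rewrite trmx_mul trmxK -mulmxA (mulmxA Z) mulmx_coker mulmx0.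
Qed.

End FilteredData.

(** * The adaptive law and the closed loop *)

Section ClosedLoop.
Variable R : realType.
Local Notation mu := (@lebesgue_measure R).

Lemma ode_col (J : set R) a b (z v : R -> 'M[R]_(a, b)) j :
  ode_on J z v -> ode_on J (fun t => col j (z t)) (fun t => col j (v t)).
Proof.
move=> zv t Jt i i'; have [ii ei] := zv t Jt i j.
have vE : (fun s => col j (v s) i i') = (fun s => v s i j).
  by apply/funext => s; rewrite mxE.
rewrite !mxE vE; split=> //.
by have -> : (fun s => (col j (v s) i i')%:E) = (fun s => (v s i j)%:E)
  by apply/funext => s; rewrite mxE.
Qed.

(** Put xi = K (Psi - Ps) for a full rank factorization D = B K.  Then
    xi' = - K G B xi after T0, a stable autonomous system, and
    D Psi - Rm = B xi. *)
Lemma adaptive_convergence k l (G D : 'M[R]_k) (Rm Ps : 'M[R]_(k, l))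
    (Psi : R -> 'M[R]_(k, l)) (Dt : R -> 'M[R]_k) (T0 : R) :
  posdef G -> D^T = D -> (forall a : 'cV[R]_k, 0 <= (a^T *m D *m a) 0 0) ->
  Rm = D *m Ps -> 0 <= T0 -> (forall t, T0 <= t -> Dt t = D) ->
  ode_on `[0, +oo[%classic Psi (fun t => - (G *m (Dt t *m Psi t - Rm))) ->
  forall b, 0 < b -> exists2 t0, T0 <= t0 & forall t, t0 <= t -> `|D *m Psi t - Rm| <= b.
Proof.
move=> Gp Ds D0 RmE T00 DtD hPsi b b0.
pose B := col_base D; pose K := row_base D.
have DE : D = B *m K by rewrite mulmx_base.
have DE' c (w : 'M[R]_(k, c)) : D *m w = B *m (K *m w) by rewrite mulmxA -DE.
have sA := reduced_gradient_stable Gp Ds D0 DE (col_base_full D) (row_base_free D).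
set A := - (K *m G *m B) in sA.
pose c := b / ((\rank D)%:R * `|B| + 1).
have den : 0 < (\rank D)%:R * `|B| + 1 by rewrite ltr_wpDl // mulr_ge0.
have c0 : 0 < c by rewrite divr_gt0.
have /choice[tj tjP] : forall j : 'I_l, exists t0, 0 <= t0 /\
    forall t, t0 <= t -> `|K *m (col j (Psi t) - col j Ps)| <= c.
  move=> j.
  have hxi := ode_on_mull K (ode_onD (ode_col j hPsi)
    (@ode_on_cst _ `[0, +oo[%classic _ _ (- col j Ps))).
  have [|t0 t00 H] := stable_vanishing sA hxi _ c0; last by exists t0.
  move=> e e0; exists T0 => //; apply: aeW => u uT.
  rewrite addr0 DtD // RmE -mulmxBr.
  have -> : col j (- (G *m (D *m (Psi u - Ps)))) =
      - (G *m (D *m (col j (Psi u) - col j Ps))).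
    by rewrite !colE mulNmx -!mulmxA mulmxBl.
  rewrite DE' /A mulNmx mulmxN !mulmxA subrr normr0; exact: ltW.
exists (T0 + \sum_j tj j); first by rewrite lerDl; apply: sumr_ge0 => j _; exact: (tjP j).1.
move=> t tt.
have xi : `|K *m (Psi t - Ps)| <= c.
  apply/mx_norm_leP => [|i j]; first exact: ltW.
  have := (tjP j).2 t.
  have -> : K *m (col j (Psi t) - col j Ps) = col j (K *m (Psi t - Ps)).
    by rewrite !colE -mulmxA mulmxBl.
  move=> H; apply: le_trans (H _); last first.
    apply: le_trans tt; rewrite (bigD1 j) //= addrCA lerDl addr_ge0 //.
    by apply: sumr_ge0 => j' _; exact: (tjP j').1.
  by have := entry_le_mx_norm (col j (K *m (Psi t - Ps))) i 0; rewrite mxE.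
have -> : D *m Psi t - Rm = B *m (K *m (Psi t - Ps)).
  by rewrite RmE -mulmxBr DE'.
apply: le_trans (mx_norm_mulmx _ _) _.
apply: le_trans (ler_wpM2l _ xi) _; first by rewrite mulr_ge0.
rewrite /c mulrA ler_pdivrMr // mulrC ler_wpM2l ?(ltW b0) //; lra.
Qed.

(** With F = [-A_s I] - Delta, the data give B_s U = F D, so B_s U Psi = F (D Psi),
    which is F Rm up to the adaptation error; and [-A_s I] Rm = [A_m - A_s  B_m]
    cancels the unknown A_s. *)
Lemma closed_loop_field (n m p : nat) (As Am : 'M[R]_n) (Bs : 'M[R]_(n, m))
    (Bm : 'M[R]_(n, p)) (D : 'M[R]_(n + n)) (Ps Psi : 'M[R]_(n + n, n + p))
    (U : 'M[R]_(m, n + n)) (Wbar Delta : 'M[R]_(n, n + n))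
    (x : 'cV[R]_n) (r : 'cV[R]_p) :
  let Rm := block_mx 1%:M 0 Am Bm in
  Bs *m U = row_mx (- As) 1%:M *m D - Wbar -> Wbar = Delta *m D -> Rm = D *m Ps ->
  As *m x + Bs *m (U *m Psi *m col_mx x r) =
    (Am - Wbar *m lsubmx Ps) *m x + (Bm - Wbar *m rsubmx Ps) *m r +
    (row_mx (- As) 1%:M - Delta) *m (D *m Psi - Rm) *m col_mx x r.
Proof.
move=> Rm BU WD RmE.
pose F := row_mx (- As) 1%:M - Delta.
have FRm : F *m Rm = row_mx (Am - As) Bm - Wbar *m Ps.
  rewrite /F mulmxBl {2}RmE mulmxA -WD; congr (_ - _).
  by rewrite /Rm mul_row_block mulmx1 mul1mx mulmx0 add0r mul1mx addrC.
have -> : Bs *m (U *m Psi *m col_mx x r) = F *m (D *m Psi) *m col_mx x r.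
  have FD : F *m D = row_mx (- As) 1%:M *m D - Wbar by rewrite /F mulmxBl WD.
  by rewrite !mulmxA BU FD.
have WPs : Wbar *m Ps = row_mx (Wbar *m lsubmx Ps) (Wbar *m rsubmx Ps).
  by rewrite -mul_mx_row hsubmxK.
have FRc : F *m Rm *m col_mx x r =
    Am *m x - As *m x + Bm *m r - (Wbar *m lsubmx Ps *m x + Wbar *m rsubmx Ps *m r).
  by rewrite FRm WPs mulmxBl !mul_row_col mulmxBl.
rewrite (mulmxBr F) (mulmxBl (F *m _)) FRc (mulmxBl Am) (mulmxBl Bm).
move: (F *m _ *m _) (As *m x) (Am *m x) (Bm *m r) (_ *m x) (_ *m r).
by move=> a b c d e f; apply/colP => i; rewrite !mxE; ring.
Qed.

Lemma scalar_form (k l : nat) (A : 'M[R]_(l, k)) (v : 'cV[R]_k) :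
  (v^T *m (A^T *m A) *m v) 0 0 = ((A *m v)^T *m (A *m v)) 0 0.
Proof. by rewrite trmx_mul !mulmxA. Qed.

(** For w = Ps1 v one has D w = (v, A_m v), so the noise bound
    |Wbar w| <= gamma |D w| is the claimed inequality. *)
Lemma data_consistent_perturbation (n p : nat) (Am : 'M[R]_n) (Bm : 'M[R]_(n, p))
    (D : 'M[R]_(n + n)) (Ps : 'M[R]_(n + n, n + p)) (Wbar : 'M[R]_(n, n + n)) (gamma : R) :
  block_mx 1%:M 0 Am Bm = D *m Ps -> D^T = D ->
  loewner_le (Wbar^T *m Wbar) (gamma ^+ 2 *: (D *m D)) ->
  forall v : 'cV[R]_n,
    (((- (Wbar *m lsubmx Ps)) *m v)^T *m ((- (Wbar *m lsubmx Ps)) *m v)) 0 0 <=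
    (v^T *m (gamma ^+ 2 *: (1%:M + Am^T *m Am)) *m v) 0 0.
Proof.
move=> RmE Ds [_ W] v; pose w := lsubmx Ps *m v.
have Dw : D *m w = col_mx v (Am *m v).
  have -> : w = Ps *m col_mx v 0.
    by rewrite -[Ps in RHS]hsubmxK mul_row_col mulmx0 addr0.
  by rewrite mulmxA -RmE mul_block_col !mulmx0 !addr0 mul1mx.
have /= := W w; rewrite mulmxBr mulmxBl mxE [X in _ + X]mxE subr_ge0 scalar_form.
have -> : - (Wbar *m lsubmx Ps) *m v = - (Wbar *m w) by rewrite mulNmx -mulmxA.
have -> : (- (Wbar *m w))^T *m - (Wbar *m w) = (Wbar *m w)^T *m (Wbar *m w).
  by rewrite mulmxN linearN /= mulNmx opprK.
move=> H; apply: le_trans H _.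
rewrite -!scalemxAr -!scalemxAl mxE [leRHS]mxE -[X in X *m D]Ds scalar_form Dw.
rewrite tr_col_mx mul_row_col mulmxDr mulmxDl mulmx1.
have -> : (Am *m v)^T *m (Am *m v) = v^T *m (Am^T *m Am) *m v.
  by rewrite trmx_mul !mulmxA.
exact: lexx.
Qed.

End ClosedLoop.

(** * Norms, essential bounds and sampling *)

Section Signals.
Variable R : realType.
Local Notation mu := (@lebesgue_measure R).

Lemma mx_norm_le_enorm k (v : 'cV[R]_k) : `|v| <= enorm v.
Proof.
apply/mx_norm_leP => [|i j]; first exact: sqrtr_ge0.
rewrite ord1 -sqrtr_sqr; apply: ler_wsqrtr.
by rewrite (bigD1 i) //= lerDl; apply: sumr_ge0 => l _; exact: sqr_ge0.
Qed.

Lemma enorm_le_mx_norm k (v : 'cV[R]_k) : enorm v <= k%:R * `|v|.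
Proof.
have kv : 0 <= k%:R * `|v| by rewrite mulr_ge0.
rewrite -(ger0_norm kv) -sqrtr_sqr; apply: ler_wsqrtr.
apply: le_trans (_ : \sum_(i < k) `|v| ^+ 2 <= _).
  apply: ler_sum => i _; rewrite -real_normK ?num_real //.
  by rewrite lerXn2r ?nnegrE ?entry_le_mx_norm.
rewrite sumr_const card_ord -[leLHS]mulr_natl exprMn ler_wpM2r ?sqr_ge0 //.
by rewrite -natrX ler_nat; case: k {v kv} => // k; rewrite expnS expn1 leq_pmulr.
Qed.

Lemma mx_norm_col_mx k l (x : 'cV[R]_k) (y : 'cV[R]_l) :
  `|col_mx x y| <= `|x| + `|y|.
Proof.
apply/mx_norm_leP => [|i j]; first by rewrite addr_ge0.
rewrite mxE; case: (fintype.split i) => i'.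
  by rewrite (le_trans (entry_le_mx_norm x i' j)) // lerDl.
by rewrite (le_trans (entry_le_mx_norm y i' j)) // lerDr.
Qed.

Lemma ae_norm_bound k (f : R -> 'cV[R]_k) : ess_bounded `[0, +oo[%classic f ->
  exists2 B, 0 <= B & {ae mu, forall t, 0 <= t -> `|f t| <= B}.
Proof.
move=> [_ [B fB]]; exists `|B| => //.
move: fB; apply: (@filterS _ _ (ae_filter_ringOfSetsType mu)) => t ft t0.
apply: le_trans (mx_norm_le_enorm _) _; apply: le_trans (ler_norm B).
by apply: ft; rewrite /= in_itv /= andbT.
Qed.

Lemma Linfty_of_bound k (f : R -> 'cV[R]_k) B :
  (forall i, measurable_fun (`[0, +oo[%classic : set R) (fun t => f t i 0)) ->
  {ae mu, forall t, 0 <= t -> `|f t| <= B} -> Linfty f.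
Proof.
move=> mf fB; split=> //; exists (k%:R * B).
move: fB; apply: (@filterS _ _ (ae_filter_ringOfSetsType mu)) => t ft.
rewrite /= in_itv /= andbT => /ft ftB.
by apply: le_trans (enorm_le_mx_norm _) _; rewrite ler_wpM2l.
Qed.

Lemma limf_esup_le (g : R -> R) (c t0 : R) : (forall t, t0 <= t -> g t <= c) ->
  (limf_esup (fun t => (g t)%:E) +oo%R <= c%:E)%E.
Proof.
move=> gc; rewrite /limf_esup.
apply: (@le_trans _ _ (ereal_sup [set (g t)%:E | t in [set t | t0 <= t]])).
  apply: ereal_inf_lbound; exists [set t | t0 <= t] => //.
  exact: nbhs_pinfty_ge (num_real t0).
by apply: ge_ereal_sup => _ [t tt <-]; rewrite lee_fin gc.
Qed.

Lemma limf_esup_le0 (g : R -> R) :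
  (forall b, 0 < b -> exists t0, forall t, t0 <= t -> g t <= b) ->
  (limf_esup (fun t => (g t)%:E) +oo%R <= 0%:E)%E.
Proof.
move=> gb; apply/lee_addgt0Pr => b b0; have [t0 tb] := gb b b0.
by rewrite add0e; exact: limf_esup_le tb.
Qed.

Lemma filter_input_measurable (rho : R) k (z zf : R -> 'cV[R]_k) i :
  filter_of rho `[0, +oo[%classic z zf ->
  measurable_fun (`[0, +oo[%classic : set R) (fun t => z t i 0).
Proof.
move=> [_ hz].
have mzf := ode_measurable i 0 hz.
have mv : measurable_fun (`[0, +oo[%classic : set R) (fun t => (- rho *: zf t + z t) i 0).
  have -> : `[0, +oo[%classic = \bigcup_k `[0, k%:R]%classic :> set R.
    by rewrite itv_bndy_bigcup_BRight; apply: eq_bigcupr => l _; rewrite add0r.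
  apply/measurable_fun_bigcup => [l|l]; first exact: measurable_itv.
  have lJ : (`[0, +oo[%classic : set R) l%:R by rewrite /= in_itv /= andbT.
  have [iv _] := hz _ lJ i 0.
  by apply/measurable_realfun.measurable_EFinP; exact: measurable_int iv.
have -> : (fun t => z t i 0) =
    (fun t => (- rho *: zf t + z t) i 0 + rho * zf t i 0).
  by apply/funext => t; rewrite !mxE; ring.
by apply: measurable_realfun.measurable_funD => //; apply: measurable_realfun.measurable_funM.
Qed.

Lemma sample_index_le (M : nat) (ts : nat -> R) t : (sample_index M ts t <= M)%N.
Proof. by apply/bigmax_leqP => j _; rewrite -ltnS. Qed.

Lemma sample_index_final (M : nat) (ts : nat -> R) t : ts M <= t -> sample_index M ts t = M.
Proof.
move=> Mt; apply/eqP; rewrite eqn_leq sample_index_le /=.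
exact: (@leq_bigmax_cond _ (fun j : 'I_M.+1 => (ts j <= t)%R) (fun j => j : nat) ord_max Mt).
Qed.

Lemma averaged_signal_bounded (a b N M : nat) (ts : nat -> R) (S0 : 'M[R]_(a, b)) inc :
  exists2 B, 0 <= B & forall t, `|averaged_signal N M ts S0 inc t| <= B.
Proof.
exists (\sum_(j < M.+1) `|running_average N S0 inc j|); first exact: sumr_ge0.
move=> t; have jM : (sample_index M ts t < M.+1)%N by rewrite ltnS sample_index_le.
by rewrite /averaged_signal (bigD1 (Ordinal jM)) //= lerDl sumr_ge0.
Qed.

Lemma sampling_times_ge0 (M : nat) (ts : nat -> R) : ts 0%N = 0 ->
  (forall j, (j < M)%N -> ts j < ts j.+1) -> forall j, (j <= M)%N -> 0 <= ts j.
Proof.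
move=> ts0 tsS; elim=> [|j IH] jM; first by rewrite ts0.
by apply: le_trans (IH (ltnW jM)) (ltW (tsS j jM)).
Qed.

End Signals.

(** * Stability and tracking of the closed loop *)

Theorem theorem3 (R : realType) (n m p q : nat) (hpm : (p <= m)%N)
    (* plant, reference model, filter constant *)
    (As : 'M[R]_n) (Bs : 'M[R]_(n, m)) (Es : 'M[R]_(n, q))
    (Am : 'M[R]_n) (Bm : 'M[R]_(n, p))
    (hAm : hurwitz Am) (hctrb : controllable Am Bm)
    (rho : R) (hrho : 0 < rho)
    (* offline trajectory (subscript o) and its sampling times *)
    (T : R) (uo ufo : R -> 'cV[R]_m) (xo xfo : R -> 'cV[R]_n)
    (wo wfo : R -> 'cV[R]_q)
    (hoff : filtered_trajectory As Bs Es rho `[0, T]%classic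
              uo xo wo ufo xfo wfo)
    (N : nat) (hN : (0 < N)%N) (tau : 'I_N -> R)
    (htau : forall j, 0 < tau j <= T)
    (htau_incr : forall j k : 'I_N, (j < k)%N -> tau j < tau k)
    (* online sampling times *)
    (M : nat) (hM : (0 < M)%N) (ts : nat -> R) (hts0 : ts 0%N = 0)
    (hts_incr : forall j, (j < M)%N -> ts j < ts j.+1)
    (* design parameters; any norm on matrices *)
    (Gamma : 'M[R]_(n + n)) (hGamma : posdef Gamma)
    (gamma : R) (hgamma : 0 < gamma)
    (nu : 'M[R]_(n, n + n) -> R) (hnu : matrix_norm nu)
    (* online signals *)
    (r : R -> 'cV[R]_p) (hr : Linfty r)
    (u uf : R -> 'cV[R]_m) (x xf : R -> 'cV[R]_n) (w wf : R -> 'cV[R]_q)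
    (hon : filtered_trajectory As Bs Es rho `[0, +oo[%classic u x w uf xf wf)
    (xm : R -> 'cV[R]_n)
    (hxm : ode_on `[0, +oo[%classic xm (fun t => Am *m xm t + Bm *m r t))
    (Psi : R -> 'M[R]_(n + n, n + p)) :
  let Rm : 'M[R]_(n + n, n + p) := block_mx 1%:M 0 Am Bm in
  (* offline data *)
  let XD := snapshots (xdf rho xo xfo) tau in
  let X := snapshots xfo tau in
  let U := snapshots ufo tau in
  let W := snapshots wfo tau in
  (* offline data extended with the online samples *)
  let tsM := fun j : 'I_M => ts j.+1 in
  let XDM := row_mx XD (snapshots (xdf rho x xf) tsM) in
  let XM := row_mx X (snapshots xf tsM) in
  let WM := row_mx W (snapshots wf tsM) in
  let Wbar : 'M[R]_(n, n + n) :=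
    ((N + M)%:R)^-1 *: (Es *m WM *m (col_mx XM XDM)^T) in
  (* the piecewise constant signals *)
  let z := fun t => col_mx (xf t) (xdf rho x xf t) in
  let Ut := averaged_signal N M ts (N%:R^-1 *: (U *m (col_mx X XD)^T))
              (fun j => uf (ts j) *m (z (ts j))^T) in
  let Dt := averaged_signal N M ts
              (N%:R^-1 *: (col_mx X XD *m (col_mx X XD)^T))
              (fun j => z (ts j) *m (z (ts j))^T) in
  let Q := gamma ^+ 2 *: (1%:M + Am^T *m Am) in
  let e := fun t => x t - xm t in
  loewner_le (Wbar^T *m Wbar) (gamma ^+ 2 *: (Dt (ts M) *m Dt (ts M))) ->
  (* im Rm is contained in im D(t_M): row spaces of the transposes *)
  (Rm^T <= (Dt (ts M))^T)%MS ->
  (forall c : R[i], eigenvalue (toC (Theta Q Am)) c -> complex.Re c != 0) ->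
  ode_on `[0, +oo[%classic Psi
    (fun t => - (Gamma *m (Dt t *m Psi t - Rm))) ->
  (forall t, 0 <= t -> u t = Ut t *m Psi t *m col_mx (x t) (r t)) ->
  hermitian_negdef (Lambda Q Am 0) ->
  [/\ Linfty x, Linfty u, Linfty e
    & (* excludes noise that vanishes from the data but persists online *)
      (Wbar = 0 -> enorm (Es *m wf t) @[t --> +oo%R] --> (0 : R)) ->
      exists f : R -> R, class_N0 f /\
        (limf_esup (fun t => (enorm (e t))%:E) +oo%R <= (f (nu Wbar))%:E)%E].
Proof.
move=> Rm XD X U W tsM XDM XM WM Wbar z Ut Dt Q e hW hR hTheta hPsi hu hLam.
have [hx hw huf hxf hwf] := hon.
have rho0 : 0 <= rho := ltW hrho.
have T00 : 0 <= ts M by exact: (sampling_times_ge0 hts0 hts_incr).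
pose UM := row_mx U (snapshots uf tsM).
pose Z := col_mx XM XDM.
pose D := Dt (ts M); pose UT := Ut (ts M).
have DtD t : ts M <= t -> Dt t = D.
  by move=> tM; rewrite /D /Dt /averaged_signal !sample_index_final.
have UtU t : ts M <= t -> Ut t = UT.
  by move=> tM; rewrite /UT /Ut /averaged_signal !sample_index_final.
have ZE : Z = row_mx (col_mx X XD) (snapshots z tsM).
  by rewrite /Z /XM /XDM -block_mxEv block_mxEh snapshots_col_mx.
have DE : D = (N + M)%:R^-1 *: (Z *m Z^T).
  rewrite /D /Dt /averaged_signal sample_index_final // running_average_gram //.
  by rewrite -ZE.
have UTE : UT = (N + M)%:R^-1 *: (UM *m Z^T).
  rewrite /UT /Ut /averaged_signal sample_index_final // running_average_gram //.
  by rewrite -ZE.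
have NM0 : ((N + M)%:R : R) != 0 by rewrite pnatr_eq0 addn_eq0 negb_and -lt0n hN.
have NMi : 0 <= ((N + M)%:R^-1 : R) by rewrite invr_ge0.
have Ds : D^T = D by rewrite DE linearZ /= trmx_mul trmxK.
have D0 (a : 'cV[R]_(n + n)) : 0 <= (a^T *m D *m a) 0 0.
  have -> : a^T *m D *m a = (N + M)%:R^-1 *: ((Z^T *m a)^T *m (Z^T *m a)).
    by rewrite DE -scalemxAr -scalemxAl trmx_mul trmxK !mulmxA.
  rewrite mxE mulr_ge0 // mxE.
  by apply: sumr_ge0 => i _; rewrite mxE -expr2 sqr_ge0.
have data : XDM = As *m XM + Bs *m UM + Es *m WM.
  rewrite /XDM /XM /UM /WM !mul_mx_row !add_row_mx; congr row_mx.
    apply/matrixP => i j; rewrite !mxE.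
    have /andP[tau0 tauT] := htau j.
    have jT : 0 <= tau j <= T by rewrite (ltW tau0).
    have := filter_identity rho0 hoff (@subset_refl _ _) jT.
    move=> /matrixP/(_ i 0); rewrite !mxE => ->.
    by congr (_ + _ + _); apply: eq_bigr => l _; rewrite mxE.
  apply/matrixP => i j; rewrite !mxE.
  have jT : 0 <= tsM j <= tsM j by rewrite lexx andbT (sampling_times_ge0 hts0 hts_incr).
  have := filter_identity rho0 hon (@sub_itv0y R _) jT.
  move=> /matrixP/(_ i 0); rewrite !mxE => ->.
  by congr (_ + _ + _); apply: eq_bigr => l _; rewrite mxE.
have WbarE : Wbar = (N + M)%:R^-1 *: (Es *m WM *m Z^T) by [].
have BU : Bs *m UT = row_mx (- As) 1%:M *m D - Wbar.
  have RZ : row_mx (- As) 1%:M *m Z = Bs *m UM + Es *m WM.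
    by rewrite mul_row_col mul1mx mulNmx data -addrA addKr.
  rewrite DE -[in RHS]scalemxAr [in RHS]mulmxA RZ mulmxDl scalerDr WbarE addrK.
  by rewrite UTE -scalemxAr mulmxA.
have [Y0 Y0E] := gram_factor UM Z.
have [V0 V0E] := gram_factor (Es *m WM) Z.
have UY : UT = Y0 *m D by rewrite UTE DE -scalemxAr Y0E.
have WV : Wbar = V0 *m D by rewrite WbarE DE -scalemxAr V0E.
have [Ps RmE] : exists Ps, Rm = D *m Ps.
  have /submxP[G GE] := hR; exists G^T.
  by apply: trmx_inj; rewrite trmx_mul trmxK GE.
have conv := adaptive_convergence hGamma Ds D0 RmE T00 DtD hPsi.
pose A := Am - Wbar *m lsubmx Ps; pose G := Bm - Wbar *m rsubmx Ps.
pose F := row_mx (- As) 1%:M - V0.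
have Qs : Q^T = Q.
  by rewrite /Q linearZ /= linearD /= trmx1 trmx_mul trmxK.
have sA : stable_spectrum (toC A).
  apply: (quadratically_bounded_stable Qs hAm hTheta hLam).
  exact: (data_consistent_perturbation RmE Ds hW).
have [Cr Cr0 rC] := ae_norm_bound hr.
have [Cw Cw0 wC] := ae_norm_bound hw.
have field t : ts M <= t ->
    As *m x t + Bs *m u t + Es *m w t =
    A *m x t + G *m r t + F *m (D *m Psi t - Rm) *m col_mx (x t) (r t) + Es *m w t.
  move=> tM; rewrite hu ?(le_trans T00) // UtU //.
  by rewrite (closed_loop_field (Psi t) (x t) (r t) BU WV RmE).
pose cF := (n + p)%:R * ((n + n)%:R * `|F|).
have cF0 : 0 <= cF by rewrite !mulr_ge0.
have FE t : `|F *m (D *m Psi t - Rm) *m col_mx (x t) (r t)| <=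
    cF * `|D *m Psi t - Rm| * (`|x t| + `|r t|).
  apply: le_trans (mx_norm_mulmx _ _) _.
  apply: ler_pM; [exact: mulr_ge0|exact: normr_ge0| |exact: mx_norm_col_mx].
  by rewrite /cF -mulrA ler_wpM2l // mx_norm_mulmx.
have [Sx Sx0 xS] : exists2 S, 0 <= S & forall t, 0 <= t -> `|x t| <= S.
  have [eps eps0 bounded] := stable_bounded sA.
  have [t1 t1M tE] := conv (eps / (cF + 1)) (divr_gt0 eps0 (ltr_wpDl cF0 ltr01)).
  apply: (bounded x _ t1 (p%:R * `|G| * Cr + eps * Cr + q%:R * `|Es| * Cw)
           (le_trans T00 t1M) _ hx).
    by rewrite !addr_ge0 // !mulr_ge0 // ltW.
  move: rC wC; apply: (@filterS2 _ _ (ae_filter_ringOfSetsType _)) => t rt wt t1t.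
  have t0 : 0 <= t by apply: le_trans T00 (le_trans t1M t1t).
  have cancel4 (a b c d : 'cV[R]_n) : a + b + c + d - a = b + c + d.
    by apply/colP => i; rewrite !mxE; ring.
  rewrite field ?(le_trans t1M) // cancel4.
  apply: le_trans (ler_normD _ _) _; apply: le_trans (lerD (ler_normD _ _) (lexx _)) _.
  have gr : `|G *m r t| <= p%:R * `|G| * Cr.
    by apply: le_trans (mx_norm_mulmx _ _) _; rewrite ler_wpM2l ?mulr_ge0 ?rt.
  have ew : `|Es *m w t| <= q%:R * `|Es| * Cw.
    by apply: le_trans (mx_norm_mulmx _ _) _; rewrite ler_wpM2l ?mulr_ge0 ?wt.
  have fe : `|F *m (D *m Psi t - Rm) *m col_mx (x t) (r t)| <= eps * (`|x t| + Cr).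
    apply: le_trans (FE t) _; apply: ler_pM; [exact: mulr_ge0|exact: addr_ge0| |].
      apply: le_trans (ler_wpM2l cF0 (tE t t1t)) _.
      rewrite mulrCA ler_piMr ?(ltW eps0) // ler_pdivrMr ?ltr_wpDl //.
      by rewrite mul1r lerDl.
    by rewrite lerD2l rt.
  lra.
have stm := hurwitz_stable hAm.
have [Sm Sm0 xmS] : exists2 S, 0 <= S & forall t, 0 <= t -> `|xm t| <= S.
  have [eps eps0 bounded] := stable_bounded stm.
  apply: (bounded xm _ 0 (p%:R * `|Bm| * Cr) (lexx _) _ hxm); first by rewrite !mulr_ge0.
  move: rC; apply: (@filterS _ _ (ae_filter_ringOfSetsType _)) => t rt t0.
  rewrite [X in `|X|]addrC addKr; apply: le_trans (mx_norm_mulmx _ _) _.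
  apply: le_trans (_ : p%:R * `|Bm| * Cr <= _); first by rewrite ler_wpM2l ?mulr_ge0 ?rt.
  by rewrite lerDr mulr_ge0 // ltW.
(* after the last sample U Psi = Y0 D Psi, so the convergence of D Psi is enough *)
have [Cu Cu0 UPsi] : exists2 S, 0 <= S & forall t, 0 <= t -> `|Ut t *m Psi t| <= S.
  have [t1 t1M tE] := conv 1 ltr01.
  have t10 : 0 <= t1 := le_trans T00 t1M.
  have [SP SP0 PS] := ode_locally_bounded t10 (ode_on_subset (@sub_itv0y R t1) hPsi).
  have [BUt BUt0 UtB] := averaged_signal_bounded N M ts (N%:R^-1 *: (U *m (col_mx X XD)^T))
    (fun j => uf (ts j) *m (z (ts j))^T).
  exists ((n + n)%:R * BUt * SP + (n + n)%:R * `|Y0| * (1 + `|Rm|)).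
    by rewrite addr_ge0 // !mulr_ge0 // addr_ge0.
  move=> t t0; have [tt1|/ltW t1t] := leP t t1.
    apply: le_trans (mx_norm_mulmx _ _) _.
    apply: le_trans (_ : (n + n)%:R * BUt * SP <= _).
      by apply: ler_pM; rewrite ?mulr_ge0 ?ler_wpM2l ?PS ?t0.
    by rewrite lerDl !mulr_ge0 // addr_ge0.
  rewrite UtU ?(le_trans t1M) // UY -mulmxA.
  apply: le_trans (mx_norm_mulmx _ _) _.
  apply: le_trans (_ : (n + n)%:R * `|Y0| * (1 + `|Rm|) <= _); last first.
    by rewrite lerDr !mulr_ge0.
  rewrite ler_wpM2l ?mulr_ge0 //.
  apply: le_trans (_ : `|D *m Psi t - Rm| + `|Rm| <= _); last by rewrite lerD2r tE.
  by apply: le_trans (ler_normD _ _); rewrite subrK.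
have mx i : measurable_fun (`[0, +oo[%classic : set R) (fun t => x t i 0).
  exact: ode_measurable hx.
have mxm i : measurable_fun (`[0, +oo[%classic : set R) (fun t => xm t i 0).
  exact: ode_measurable hxm.
have eS t : 0 <= t -> `|e t| <= Sx + Sm.
  by move=> t0; apply: le_trans (ler_normB _ _) (lerD (xS t t0) (xmS t t0)).
have eS0 : 0 <= n%:R * (Sx + Sm) by rewrite mulr_ge0 // addr_ge0.
split.
- by apply: (@Linfty_of_bound _ _ _ Sx mx); exact: aeW.
- apply: (@Linfty_of_bound _ _ _ ((n + p)%:R * Cu * (Sx + Cr))).
    by move=> i; exact: filter_input_measurable huf.
  move: rC; apply: (@filterS _ _ (ae_filter_ringOfSetsType _)) => t rt t0.
  rewrite hu //; apply: le_trans (mx_norm_mulmx _ _) _.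
  apply: ler_pM; [exact: mulr_ge0|exact: normr_ge0|by rewrite ler_wpM2l ?UPsi|].
  by apply: le_trans (mx_norm_col_mx _ _) _; rewrite lerD ?xS ?rt.
- apply: (@Linfty_of_bound _ _ _ (Sx + Sm)); last by exact: aeW.
  move=> i; have -> : (fun t => e t i 0) = (fun t => x t i 0 - xm t i 0).
    by apply/funext => t; rewrite !mxE.
  exact: measurable_realfun.measurable_funB.
move=> wf_van; have [nu_ge0 nu_eq0 nuZ _] := hnu.
have [W0|W0] := eqVneq Wbar 0; last first.
  (* any bound on e is a multiple of the fixed nonzero number nu Wbar *)
  have nuW : 0 < nu Wbar.
    by rewrite lt_neqAle nu_ge0 andbT eq_sym; apply: contraNneq W0 => /nu_eq0 ->.
  exists (fun s => s * (n%:R * (Sx + Sm) / nu Wbar)); split.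
    split=> [|s s0|s s' s0 ss'|]; last by rewrite mul0r.
    - apply: continuous_subspaceT => s; apply: cvgM; [exact: cvg_id|exact: cvg_cst].
    - by rewrite mulr_ge0 // divr_ge0.
    - by rewrite ler_wpM2r // divr_ge0.
  rewrite mulrCA divff ?mulr1 ?gt_eqF //; apply: (@limf_esup_le _ _ _ 0) => t t0.
  by apply: le_trans (enorm_le_mx_norm _) _; rewrite ler_wpM2l ?eS.
exists (fun=> 0); split.
  split=> //; by apply: continuous_subspaceT => s; exact: cvg_cst.
apply: limf_esup_le0 => b b0.
have wf_small c : 0 < c -> exists2 t0, 0 <= t0 & forall t, t0 <= t -> `|Es *m wf t| <= c.
  move=> c0; have := wf_van W0 => /cvgr_lt/(_ _ c0)[t0 [_ t0P]].
  exists (`|t0| + 1); first by rewrite addr_ge0.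
  move=> t t0t; apply: le_trans (mx_norm_le_enorm _) (ltW (t0P t _)).
  by apply: lt_le_trans t0t; rewrite ltr_pwDr // ler_norm.
have AE : A = Am by rewrite /A W0 mul0mx subr0.
have GE : G = Bm by rewrite /G W0 mul0mx subr0.
(* subtracting the filtered noise turns the forcing Es w into a vanishing one *)
have [_ hwf'] := hwf.
have herr := ode_onD (ode_onD hx (ode_onZ (-1) hxm)) (ode_onZ (-1) (ode_on_mull Es hwf')).
pose ef t := x t + (-1) *: xm t + (-1) *: (Es *m wf t).
have van : forall c, 0 < c -> exists2 t0, 0 <= t0 & forall t, t0 <= t -> `|ef t| <= c.
  apply: (stable_vanishing stm herr) => c c0.
  pose k1 := n%:R * `|Am| + rho; have k10 : 0 <= k1 by rewrite addr_ge0 // mulr_ge0.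
  have c20 : 0 < c / 2 by rewrite divr_gt0.
  have [t1 t10 t1P] := wf_small _ (divr_gt0 c20 (ltr_wpDl k10 ltr01)).
  pose k2 := cF * (Sx + Cr); have k20 : 0 <= k2 by rewrite mulr_ge0 // addr_ge0.
  have [t2 t2M t2P] := conv _ (divr_gt0 c20 (ltr_wpDl k20 ltr01)).
  have t20 : 0 <= t2 := le_trans T00 t2M.
  exists (t1 + t2); first exact: addr_ge0.
  move: rC; apply: (@filterS _ _ (ae_filter_ringOfSetsType _)) => t rt tt.
  have tt1 : t1 <= t by apply: le_trans tt; rewrite lerDl.
  have tt2 : t2 <= t by apply: le_trans tt; rewrite lerDr.
  have t0 : 0 <= t := le_trans t10 tt1.
  have noise : `|Am *m (Es *m wf t) + rho *: (Es *m wf t)| <= c / 2.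
    apply: le_trans (ler_normD _ _) _; rewrite normrZ (ger0_norm rho0).
    apply: le_trans (lerD (mx_norm_mulmx _ _) (lexx _)) _; rewrite -mulrDl -/k1.
    apply: le_trans (ler_wpM2l k10 (t1P t tt1)) _.
    rewrite mulrCA ler_piMr ?divr_ge0 ?(ltW c0) // ler_pdivrMr ?ltr_wpDl //.
    by rewrite mul1r lerDl.
  have adapt : `|F *m (D *m Psi t - Rm) *m col_mx (x t) (r t)| <= c / 2.
    apply: le_trans (FE t) _; rewrite mulrAC.
    apply: le_trans (_ : k2 * (c / 2 / (k2 + 1)) <= _).
      apply: ler_pM; [by rewrite mulr_ge0 // addr_ge0|exact: normr_ge0| |exact: t2P].
      by rewrite ler_wpM2l // lerD ?xS ?rt.
    rewrite mulrCA ler_piMr ?divr_ge0 ?(ltW c0) // ler_pdivrMr ?ltr_wpDl //.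
    by rewrite mul1r lerDl.
  rewrite field ?(le_trans t2M) // AE GE.
  set f := F *m _ *m _ in adapt *; set v := (X in `|X| <= _).
  have -> : v = f + (Am *m (Es *m wf t) + rho *: (Es *m wf t)).
    rewrite /v !mulmxDr -!scalemxAr; clear v adapt; clearbody f.
    move: f (Am *m x t) (Am *m xm t) (Bm *m r t) (Am *m (Es *m wf t)) (Es *m wf t) (Es *m w t).
    by move=> v1 v2 v3 v4 v5 v6 v7; apply/colP => i; rewrite !mxE; ring.
  apply: le_trans (ler_normD _ _) _; lra.
(* the factor n compares the Euclidean norm with the maximum norm *)
pose b' := b / (2 * (n%:R + 1)).
have b'0 : 0 < b' by rewrite divr_gt0 // mulr_gt0 // ltr_wpDl.
have [t1 _ t1P] := van b' b'0; have [t2 _ t2P] := wf_small b' b'0.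
exists (`|t1| + `|t2|) => t tt.
have tt1 : t1 <= t by apply: le_trans (ler_norm _) (le_trans _ tt); rewrite lerDl.
have tt2 : t2 <= t by apply: le_trans (ler_norm _) (le_trans _ tt); rewrite lerDr.
have eb : `|e t| <= 2 * b'.
  have -> : e t = ef t + Es *m wf t.
    by rewrite /ef /e; apply/colP => i; rewrite !mxE; ring.
  apply: le_trans (ler_normD _ _) _; have := t1P t tt1; have := t2P t tt2; lra.
apply: le_trans (enorm_le_mx_norm _) _; apply: le_trans (ler_wpM2l _ eb) _ => //.
have -> : n%:R * (2 * b') = n%:R / (n%:R + 1) * b.
  by rewrite /b'; field; rewrite gt_eqF // ltr_wpDl.
by rewrite ler_piMl ?(ltW b0) // ler_pdivrMr ?ltr_wpDl // mul1r lerDl.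
Qed.
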